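(* Let $\mathcal H_1,\mathcal H_2,\mathcal H$ be complex Hilbert spaces and $\Theta\subset\mathbb C$ open. Let $\Theta\ni z\mapsto A_z\in\mathcal C(\mathcal H,\mathcal H_2)$ and $\Theta\ni z\mapsto B_z\in\mathcal B(\mathcal H_1,\mathcal H)$ be holomorphic. If $A_z$ and $A_zB_z$ are densely defined and $B_z^*A_z^*$ is closed for all $z\in\Theta$, then $\Theta\ni z\mapsto A_zB_z\in\mathcal C(\mathcal H_1,\mathcal H_2)$ is holomorphic.
   Context: $\mathcal B(\cdot,\cdot)$ denotes bounded everywhere defined operators, $\mathcal C(\cdot,\cdot)$ closed operators (defined on a linear subspace). The product $AB$ has domain $\mathrm{Dom}(AB)=\{v\in\mathrm{Dom}(B):Bv\in\mathrm{Dom}(A)\}$. Stars denote Hilbert space adjoints. A function $z\mapsto T_z\in\mathcal C(\mathcal H_1,\mathcal H_2)$ is complex differentiable at $z_0\in\Theta$ if there exist an open $\Theta_0$ with $z_0\in\Theta_0\subset\Theta$, a Banach space $\mathcal K$ and bounded injective operators with closed range $R_z:\mathcal K\to\mathcal H_1\oplus\mathcal H_2$, $z\in\Theta_0$, such that $R_z$ is a bijection of $\mathcal K$ onto the graph $\mathrm{Gr}(T_z)=\{(x,T_zx):x\in\mathrm{Dom}(T_z)\}$ for all $z\in\Theta_0$ and $z\mapsto R_z$ is complex differentiable at $z_0$ in operator norm. It is holomorphic if it is complex differentiable at every point of $\Theta$. For functions with values in bounded everywhere defined operators, holomorphy means the usual norm holomorphy. *)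

(* Defs.v *)
From HB Require Import structures.
From mathcomp Require Import all_boot all_order all_algebra.
From mathcomp Require Import complex.
From mathcomp Require Import all_classical all_reals ereal topology normedtype.

Set Implicit Arguments.
Unset Strict Implicit.
Unset Printing Implicit Defensive.

Import Order.TTheory GRing.Theory Num.Theory.
Import numFieldNormedType.Exports.

Local Open Scope classical_set_scope.
Local Open Scope ring_scope.

(* The library attaches the norm topology to R[i] through its numFieldType
   structure only; this makes it visible on the bare type R[i] as well. *)
HB.instance Definition _ (R : realType) := NormedModule.copy R[i] R[i]^o.

(* The inner product is linear in its first argument and conjugate-linear in
   its second one. *)
HB.mixin Record CompleteNormedModule_isHilbert (R : realType) H
    & CompleteNormedModule R[i] H := {
  inner : {dot H for (@Num.conj R[i])} ;
  sqr_norm_inner : forall x : H, `|x| ^+ 2 = inner x x }.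

#[short(type="hilbertType")]
HB.structure Definition Hilbert (R : realType) :=
  {H of CompleteNormedModule R[i] H & CompleteNormedModule_isHilbert R H}.

Notation "'<<|' x , y '|>>'" := (inner x y) : ring_scope.

Section Operators.
Context {R : realType}.
Local Notation C := R[i].

Section Normed.
Variables V W : normedModType C.

(* A partially defined map; the values of [opfun] outside [Dom] are junk and
   no notion below depends on them. *)
Record operator := Operator { Dom : set V ; opfun : V -> W }.

Definition graph (T : operator) : set (V * W) :=
  [set p | Dom T p.1 /\ p.2 = opfun T p.1].

Definition linear_operator (T : operator) : Prop :=
  Dom T 0 /\
  forall (a : C) (x y : V), Dom T x -> Dom T y ->
    Dom T (a *: x + y) /\
    opfun T (a *: x + y) = a *: opfun T x + opfun T y.

(* The product V * W carries the sup norm of the library, which is equivalent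
   to the Hilbert direct sum norm sqrt(|x|^2 + |y|^2) and defines the same
   topology. *)
Definition closed_operator (T : operator) : Prop :=
  linear_operator T /\ closed (graph T).

Definition densely_defined (T : operator) : Prop := dense (Dom T).

Definition everywhere (f : V -> W) : operator := Operator setT f.

Definition bounded_operator (f : V -> W) : Prop :=
  linear f /\ exists M : C, forall x, `|f x| <= M * `|x|.

(* The norm of a normed module over C has its values in C. *)
Definition opnorm (f : V -> W) : \bar R :=
  ereal_sup [set (complex.Re `|f x|)%:E | x in [set x : V | `|x| <= 1]].

Definition norm_differentiable (F : C -> V -> W) (z0 : C) : Prop :=
  exists2 D : V -> W, bounded_operator D &
    opnorm (fun x => (z - z0)^-1 *: (F z x - F z0 x) - D x) @[z --> z0^']
      --> 0%E.

Definition norm_holomorphic (Theta : set C) (F : C -> V -> W) : Prop :=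
  (forall z, Theta z -> bounded_operator (F z)) /\
  forall z0, Theta z0 -> norm_differentiable F z0.

End Normed.

Definition op_comp (U V W : normedModType C)
    (A : operator V W) (B : operator U V) : operator U W :=
  Operator [set v | Dom B v /\ Dom A (opfun B v)] (opfun A \o opfun B).

Section Adjoint.
Variables H1 H2 : hilbertType R.

Definition adjoint_rel (T : operator H1 H2) (y : H2) (w : H1) : Prop :=
  forall x, Dom T x -> <<| opfun T x, y |>> = <<| x, w |>>.

(* Meaningful for densely defined T, for which adjoint_rel T y determines w. *)
Definition adjoint (T : operator H1 H2) : operator H2 H1 :=
  Operator [set y | exists w, adjoint_rel T y w]
           (fun y => xget 0 [set w | adjoint_rel T y w]).

End Adjoint.

Section Holomorphy.
Variables V W : normedModType C.

Definition complex_differentiable (Theta : set C) (T : C -> operator V W)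
    (z0 : C) : Prop :=
  exists Theta0 : set C,
    [/\ open Theta0, Theta0 z0, Theta0 `<=` Theta &
    exists (K : completeNormedModType C) (Rs : C -> K -> V * W),
      (forall z, Theta0 z ->
        [/\ bounded_operator (Rs z), injective (Rs z),
            closed (range (Rs z)) & set_bij setT (graph (T z)) (Rs z)]) /\
      norm_differentiable Rs z0].

Definition holomorphic (Theta : set C) (T : C -> operator V W) : Prop :=
  (forall z, Theta z -> closed_operator (T z)) /\
  forall z0, Theta z0 -> complex_differentiable Theta T z0.

End Holomorphy.
End Operators.

(* Main.v *)
Require Import Defs.
From HB Require Import structures.
From mathcomp Require Import all_boot all_order all_algebra.
From mathcomp Require Import complex ring lra.
From mathcomp Require Import all_classical all_reals ereal topology normedtype.
From mathcomp Require Import sequences.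

(** Let r_z = (P_z, U_z) be a resolution K -> H + H2 of the graph of A_z near
    z0.  The graph of A_z B_z is the set of (x, U_z k) with E_z (x, k) = 0,
    where E_z (x, k) = B_z x - P_z k maps H1 + K to H.  If E_z0 has a bounded
    right inverse J, then E_z J is invertible for z close to z0, and
    n |-> n - J (E_z J)^-1 E_z n is a bijection from ker E_z0 onto ker E_z
    which is differentiable in z at z0; this gives the resolution of A_z B_z.

    The right inverse exists because the adjoint of E_z0 is bounded below.
    Give K the scalar product pulled back by r_z0.  Then E_z0^* h = (B^* h, g)
    where (- U g, h + P g) lies in the graph of A^*, and since B^* A^* is
    closed, the closed graph theorem bounds A^* y by y and B^* A^* y, that is
    h + P g by g and B^* h. *)

Set Implicit Arguments.
Unset Strict Implicit.
Unset Printing Implicit Defensive.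

Import Order.TTheory GRing.Theory Num.Theory.
Import numFieldNormedType.Exports.

Local Open Scope classical_set_scope.
Local Open Scope complex_scope.
Local Open Scope ring_scope.

(** * Real-valued norms *)

Section RealNorm.
Context {R : realType}.
Local Notation C := R[i].

(** Solvability of [E_z0 p = h] for every h says that the range of [B_z0] and the domain of [A_z0]
    together sum to H; this keeps the kernel of [E_z] from jumping as z moves, and it is what the
    closedness of [B^* A^*] provides. The adjoint estimate is made at z0 alone, and a Neumann series
    carries invertibility to nearby z. The obstacle is that K is merely a Banach space, so that
    [E_z0] has no Hilbert adjoint to begin with. Since [r_z0] is injective with closed range, the
    open mapping theorem bounds it below, and the pulled-back scalar product is bounded and coercive
    for the norm of K. Riesz representation is therefore proved for coercive hermitian forms on a
    Banach space, which also covers the sup norm of [H1 * K]. *)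

Definition rnorm (V : normedModType C) (x : V) : R := complex.Re `|x|.

Section Theory.
Variable V : normedModType C.
Implicit Types x y : V.

Lemma normE x : `|x| = (rnorm x)%:C.
Proof. by rewrite /rnorm RRe_real// ger0_real. Qed.

Lemma rnorm_ge0 x : 0 <= rnorm x.
Proof. by rewrite -ler0c -normE. Qed.

Lemma rnormD x y : rnorm (x + y) <= rnorm x + rnorm y.
Proof. by rewrite -lecR rmorphD/= -!normE ler_normD. Qed.

Lemma rnormZ (a : C) x : rnorm (a *: x) = rnorm a * rnorm x.
Proof. by apply: complexI; rewrite rmorphM/= -!normE normrZ. Qed.

Lemma rnormN x : rnorm (- x) = rnorm x.
Proof. by rewrite /rnorm normrN. Qed.

Lemma rnormB x y : rnorm (x - y) <= rnorm x + rnorm y.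
Proof. by rewrite -(rnormN y) rnormD. Qed.

Lemma rnorm0 : rnorm (0 : V) = 0.
Proof. by rewrite /rnorm normr0. Qed.

Lemma rnorm_eq0 x : (rnorm x = 0) -> x = 0.
Proof. by move=> h; apply/normr0_eq0; rewrite normE h. Qed.

Lemma rnorm_gt0 x : (0 < rnorm x) = (x != 0).
Proof. by rewrite -ltcR -normE normr_gt0. Qed.

Lemma rnorm_distC x y : rnorm (x - y) = rnorm (y - x).
Proof. by rewrite -rnormN opprB. Qed.

Lemma rnorm_triangle y x z : rnorm (x - z) <= rnorm (x - y) + rnorm (y - z).
Proof. by rewrite (le_trans _ (rnormD _ _))// addrA subrK. Qed.

Lemma rnorm_real (r : R) : rnorm (r%:C : C) = `|r|.
Proof. by rewrite /rnorm normc_def/= expr0n addr0 sqrtr_sqr. Qed.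

Lemma rnormZr (r : R) x : rnorm (r%:C *: x) = `|r| * rnorm x.
Proof. by rewrite rnormZ rnorm_real. Qed.

Lemma rnorm_le_eps0 x : (forall e : R, 0 < e -> rnorm x <= e) -> x = 0.
Proof.
move=> h; apply: rnorm_eq0; apply/eqP; rewrite eq_le rnorm_ge0 andbT.
by apply/ler_addgt0Pl => e e0; rewrite addr0; exact: h.
Qed.

End Theory.

Lemma Re_le_rnorm (a : C) : complex.Re a <= rnorm a.
Proof.
by rewrite (le_trans (ler_norm _))// -lecR -normE; exact: normc_ge_Re.
Qed.

Lemma rnorm_pair (V W : normedModType C) (x : V) (y : W) :
  rnorm (x, y) = Num.max (rnorm x) (rnorm y).
Proof.
apply: complexI; rewrite -normE prod_normE/= !normE.
rewrite /Order.max ltcR; by case: ifP.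
Qed.

Lemma rnorm_fst (V W : normedModType C) (p : V * W) : rnorm p.1 <= rnorm p.
Proof. by case: p => x y; rewrite rnorm_pair le_max lexx. Qed.

Lemma rnorm_snd (V W : normedModType C) (p : V * W) : rnorm p.2 <= rnorm p.
Proof. by case: p => x y; rewrite rnorm_pair le_max lexx orbT. Qed.

Lemma rnorm_pair_le (V W : normedModType C) (p : V * W) (M : R) :
  rnorm p.1 <= M -> rnorm p.2 <= M -> rnorm p <= M.
Proof. by case: p => x y /= hx hy; rewrite rnorm_pair ge_max hx. Qed.

Section Nbhs.
Variable V : normedModType C.

Lemma nbhs_rnormP (x : V) (P : set V) :
  nbhs x P <-> exists2 e : R, 0 < e & forall y, rnorm (y - x) < e -> P y.
Proof.
split=> [/nbhs_ballP[e /= e0 h]|[e e0 h]].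
  have er : e = (complex.Re e)%:C by rewrite RRe_real// gtr0_real.
  exists (complex.Re e); first by rewrite -ltcR -er.
  move=> y hy; apply: h; rewrite -ball_normE/= distrC normE er ltcR//.
apply/nbhs_ballP; exists e%:C; first by rewrite /= ltcR.
by move=> y; rewrite -ball_normE/= distrC normE ltcR; exact: h.
Qed.

Lemma closed_rnormP (S : set V) :
  closed S <->
  forall x, (forall e : R, 0 < e -> exists2 y, S y & rnorm (y - x) < e) -> S x.
Proof.
split=> [cS x h|h].
  apply: cS => P /nbhs_rnormP[e e0 hP].
  by have [y Sy yx] := h _ e0; exists y; split=> //; exact: hP.
move=> x cx; apply: h => e e0.
have [|y [Sy hy]] := cx [set y | rnorm (y - x) < e].
  by apply/nbhs_rnormP; exists e.
by exists y.
Qed.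

Lemma dense_rnormP (S : set V) :
  dense S -> forall x (e : R), 0 < e -> exists2 y, S y & rnorm (y - x) < e.
Proof.
move=> dS x e e0.
have [||y [hy Sy]] := dS [set y | rnorm (y - x) < e].
- by exists x => /=; rewrite subrr rnorm0.
- rewrite openE => y /= yx; apply/nbhs_rnormP.
  exists (e - rnorm (y - x)); first lra.
  move=> z zy /=; have := rnorm_triangle y z x; lra.
- by exists y.
Qed.

End Nbhs.

Lemma exprn_small (q M e : R) : 0 <= q -> q < 1 -> 0 < e ->
  exists n, M * q ^+ n < e.
Proof.
move=> q0 q1 e0.
have [|M0] := leP M 0.
  move=> M0; exists 0%N; rewrite expr0 mulr1; lra.
have : (fun n => geometric M q n) @ \oo --> (0 : R).
  by apply: cvg_geometric; rewrite ger0_norm.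
move=> /cvgrPdist_lt/(_ e e0)[n _ /(_ n (leqnn n))] /=.
rewrite sub0r normrN => h; exists n.
by rewrite (le_lt_trans (ler_norm _)).
Qed.

End RealNorm.

(** * Complete normed modules *)

Section Linear.
Context {K : pzRingType} {U V : lmodType K} {f : U -> V}.
Hypothesis linf : linear f.

Lemma linD x y : f (x + y) = f x + f y.
Proof. by have := linf 1 x y; rewrite !scale1r. Qed.

Lemma lin0 : f 0 = 0.
Proof. by apply: (addrI (f 0)); rewrite -linD !addr0. Qed.

Lemma linZ a x : f (a *: x) = a *: f x.
Proof. by have := linf a x 0; rewrite lin0 !addr0. Qed.

Lemma linN x : f (- x) = - f x.
Proof. by rewrite -scaleN1r linZ scaleN1r. Qed.

Lemma linB x y : f (x - y) = f x - f y.
Proof. by rewrite linD linN. Qed.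

End Linear.

Lemma linear_sub (K : pzRingType) (U V : lmodType K) (f g : U -> V) :
  linear f -> linear g -> linear (fun x => f x - g x).
Proof. by move=> lf lg a x y; rewrite lf lg opprD scalerBr addrACA. Qed.

Lemma linear_scale (K : comPzRingType) (U V : lmodType K) (c : K) (f : U -> V) :
  linear f -> linear (fun x => c *: f x).
Proof. by move=> lf a x y; rewrite lf scalerDr !scalerA mulrC. Qed.

(** The error of the product rule for [F z \o G z]: the remainder of [F] at [G z x], the remainder
    of [G] under [F z0], and the increment of the derivative of [F] between [G z0 x] and [G z x]. *)
Lemma telescope3 (V : zmodType) (a b d p q r : V) :
  a - d - (q + r) = (a - b - p) + (b - d - q) + (p - r).
Proof.
rewrite [a - b - p]addrAC -[b - d - q]addrA -opprD subrKA.
by rewrite [a - p - _]addrAC subrKA !opprD !addrA.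
Qed.

Section Banach.
Context {R : realType}.
Local Notation C := R[i].

Section BoundedOperator.
Variables V W : normedModType C.

Definition bounded_by (f : V -> W) (M : R) : Prop :=
  forall x, rnorm (f x) <= M * rnorm x.

Lemma bounded_byW (f : V -> W) (M M' : R) :
  M <= M' -> bounded_by f M -> bounded_by f M'.
Proof.
by move=> MM' fM x; rewrite (le_trans (fM x))// ler_wpM2r ?rnorm_ge0.
Qed.

Lemma bounded_operatorP (f : V -> W) :
  bounded_operator f <-> linear f /\ exists2 M : R, 0 < M & bounded_by f M.
Proof.
split=> [[lf [M hM]]|[lf [M M0 hM]]]; split=> //.
  exists (`|complex.Re M| + 1); first by rewrite ltr_wpDl.
  move=> x; have := hM x; rewrite !normE lecE => /andP[_].
  have -> : complex.Re (M * (rnorm x)%:C) = complex.Re M * rnorm x.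
    by case: (M) => a b /=; rewrite mulr0 subr0.
  move=> /le_trans; apply; rewrite ler_wpM2r ?rnorm_ge0//.
  by rewrite (le_trans (ler_norm _))// lerDl.
by exists M%:C => x; rewrite !normE -rmorphM lecR; exact: hM.
Qed.

End BoundedOperator.

Section Complete.
Variable V : completeNormedModType C.

(** The rate is kept because it serves in two ways: when [u 0 = 0] the case [n = 0] bounds the limit
    itself, and large [n] controls the error when an equation passes to the limit. *)
Lemma geometric_cvg (u : nat -> V) (M q : R) : 0 <= q -> q < 1 ->
  (forall n, rnorm (u n.+1 - u n) <= M * q ^+ n) ->
  exists l, forall n, rnorm (l - u n) <= M / (1 - q) * q ^+ n.
Proof.
move=> q0 q1 hu.
have q1' : 0 < 1 - q by lra.
have M0 : 0 <= M by have := hu 0%N; rewrite expr0 mulr1; apply: le_trans (rnorm_ge0 _).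
have hk n k : rnorm (u (n + k)%N - u n) <= M / (1 - q) * q ^+ n.
  (* The difference [q ^+ n - q ^+ (n + k)] grows by just the next term of the series, so the
     induction on [k] closes. *)
  suff : rnorm (u (n + k)%N - u n) <= M / (1 - q) * (q ^+ n - q ^+ (n + k)%N).
    move=> /le_trans; apply; rewrite ler_wpM2l ?divr_ge0 ?(ltW q1')//.
    by rewrite lerBlDr lerDl exprn_ge0.
  elim: k => [|k ih]; first by rewrite addn0 !subrr rnorm0 mulr0.
  rewrite addnS (le_trans (rnorm_triangle (u (n + k)%N) _ _))//.
  rewrite (le_trans (lerD (hu _) ih))// le_eqVlt; apply/orP; left; apply/eqP.
  rewrite exprS; field; lra.
have cu : cauchy (u @ \oo).
  apply: cauchy_exP => e e0.
  have er : e = (complex.Re e)%:C by rewrite RRe_real// gtr0_real.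
  have e0' : 0 < complex.Re e by rewrite -ltcR -er.
  have [n hn] := exprn_small (M / (1 - q)) q0 q1 e0'.
  exists (u n); exists n => // m /= nm.
  rewrite -ball_normE/= distrC normE er ltcR.
  by rewrite -(subnKC nm) (le_lt_trans (hk _ _)).
have := cauchy_cvg _ cu; set l := lim _ => ul.
exists l => n; apply/ler_addgt0Pl => e e0.
have /ul[m _ hm] : nbhs l [set y | rnorm (y - l) < e].
  by apply/nbhs_rnormP; exists e.
have := hm (m + n)%N; rewrite /= leq_addr => /(_ isT) h1.
have := hk n m; rewrite addnC => h2.
have := rnorm_triangle (u (m + n)%N) l (u n); rewrite rnorm_distC in h1; lra.
Qed.

(** Iterating [u + (g - T u)] from 0 adds the current residual, and each residual is at most [q]
    times the previous one. *)
Lemma neumann (T : V -> V) (q : R) : linear T -> 0 <= q -> q < 1 ->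
  (forall x, rnorm (T x - x) <= q * rnorm x) ->
  forall g, exists2 h, T h = g & (1 - q) * rnorm h <= rnorm g.
Proof.
move=> lT q0 q1 hT g.
pose u := fix u n := if n is n.+1 then u n + (g - T (u n)) else 0.
have uS n : u n.+1 - u n = g - T (u n) by rewrite /= addrC addKr.
have u1 n : rnorm (u n.+1 - u n) <= rnorm g * q ^+ n.
  elim: n => [|n ih]; first by rewrite /= (lin0 lT) !subr0 add0r expr0 mulr1.
  have -> : u n.+2 - u n.+1 = - (T (u n.+1 - u n) - (u n.+1 - u n)).
    by rewrite !uS opprB [u n.+1]/= (linD lT) opprD addrA.
  rewrite rnormN (le_trans (hT _))// exprS mulrCA ler_wpM2l//.
have [h hh] := geometric_cvg q0 q1 u1.
have Tb x : rnorm (T x) <= (1 + q) * rnorm x.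
  have := rnormD (T x - x) x; rewrite subrK; have := hT x; lra.
exists h; last first.
  have := hh 0%N; rewrite /= subr0 expr0 mulr1 ler_pdivlMr; last lra.
  by rewrite mulrC.
apply/eqP; rewrite -subr_eq0; apply/eqP/rnorm_le_eps0 => e e0.
pose K := rnorm g / (1 - q) * (1 + q) + rnorm g.
have [n hn] := exprn_small K q0 q1 e0.
have -> : T h - g = T (h - u n) - (u n.+1 - u n).
  by rewrite uS (linB lT) opprB addrA subrK.
have := rnormB (T (h - u n)) (u n.+1 - u n).
have := u1 n; have := Tb (h - u n); have := hh n.
move=> h1 h2 h3 h4.
have h5 : (1 + q) * rnorm (h - u n) <= (1 + q) * (rnorm g / (1 - q) * q ^+ n).
  by rewrite ler_wpM2l//; lra.
apply: le_trans (ltW hn); rewrite /K; lra.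
Qed.

End Complete.
End Banach.

(** * The open mapping theorem onto a closed range *)

Section OpenMapping.
Context {R : realType}.
Local Notation C := R[i].
Variables (V W : completeNormedModType C) (f : V -> W).
Hypothesis lf : linear f.

(* Gliding hump: were the claim false, a series with terms of size 5 ^- n
   could be chosen in the closed range so that its sum has no preimage. *)
Lemma approximate_lift : closed (range f) ->
  exists2 c : R, 0 < c & forall w, range f w ->
    exists2 v, rnorm v <= c * rnorm w & rnorm (w - f v) <= 2^-1 * rnorm w.
Proof.
move=> /closed_rnormP cf; apply: contrapT => H.
have {}H (c : R) : 0 < c -> exists2 w, range f w &
    forall v, rnorm v <= c * rnorm w -> 2^-1 * rnorm w < rnorm (w - f v).
  move=> c0; apply: contrapT => Hc; apply: H; exists c => // w fw.
  apply: contrapT => Hw; apply: Hc; exists w => // v vw.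
  by rewrite ltNge; apply/negP => wv; apply: Hw; exists v.
(* A vector that cannot be lifted, rescaled to norm [r]: any [v] of norm at most [k * r] leaves an
   error above [r / 2]. The inequality also covers larger [v], and it behaves well under averaging,
   which the choice of sign below uses. *)
have hump (k r : R) : 0 < k -> 0 < r -> exists2 u, range f u &
    rnorm u = r /\ forall v, k * r <= rnorm v + 2 * k * rnorm (u - f v).
  move=> k0 r0; have [w fw hw] := H _ k0.
  have w0 : 0 < rnorm w.
    have := hw 0; rewrite rnorm0 mulr_ge0 ?rnorm_ge0 ?(ltW k0)// => /(_ isT).
    by rewrite (lin0 lf) subr0; lra.
  have [k0' r0' w0'] : [/\ 0 <= k, 0 <= r & 0 <= rnorm w] by split; exact: ltW.
  have [v0 _ fv0] := fw.
  exists ((r / rnorm w)%:C *: w).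
    by exists ((r / rnorm w)%:C *: v0) => //; rewrite (linZ lf) fv0.
  split=> [|v]; first by rewrite rnormZr ger0_norm ?divr_ge0// divfK ?gt_eqF.
  have [|vk] := ltP (k * r) (rnorm v).
    by move=> /ltW /le_trans; apply; rewrite lerDl !mulr_ge0 ?rnorm_ge0.
  have := hw ((rnorm w / r)%:C *: v); rewrite rnormZr ger0_norm ?divr_ge0//.
  have -> : (rnorm w / r) * rnorm v = rnorm v / r * rnorm w by ring.
  rewrite ler_wpM2r// ?ler_pdivrMr// => /(_ isT).
  have -> : w - f ((rnorm w / r)%:C *: v) =
      (rnorm w / r)%:C *: ((r / rnorm w)%:C *: w - f v).
    rewrite (linZ lf) scalerBr scalerA -rmorphM/=.
    by rewrite mulrA divfK ?gt_eqF// divff ?gt_eqF// scale1r.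
  rewrite rnormZr ger0_norm ?divr_ge0// => h.
  have {}h : 2^-1 * r < rnorm ((r / rnorm w)%:C *: w - f v).
    rewrite -(ltr_pM2l (divr_gt0 w0 r0)) (le_lt_trans _ h)//.
    by rewrite mulrCA divfK ?gt_eqF.
  have : k * (2 * (2^-1 * r)) <= k * (2 * rnorm ((r / rnorm w)%:C *: w - f v)).
    by rewrite ler_wpM2l //; lra.
  have := rnorm_ge0 v; lra.
(* With [k = 10 ^+ n] and [r = 5^-1 ^+ n] the bound [k * r = 2 ^+ n] diverges while the steps are
   summable. One of [x + u] and [x - u] inherits the bound: if [v1] and [v2] violated it for them,
   half of [v1 - v2] would violate it for [u]. The range condition sits under the existential so
   that iterating needs no dependent proofs. *)
have step n x : exists y, range f x -> [/\ range f y, rnorm (y - x) <= 5^-1 ^+ n &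
    forall v, 2 ^+ n <= rnorm v + 2 * 10 ^+ n * rnorm (y - f v)].
  have [k0 r0] : (0 : R) < 10 ^+ n /\ (0 : R) < 5^-1 ^+ n.
    by split; rewrite exprn_gt0.
  have [u fu [ur hu]] := hump _ _ k0 r0.
  have kr : 10 ^+ n * 5^-1 ^+ n = 2 ^+ n :> R.
    by rewrite -exprMn; congr (_ ^+ _); lra.
  rewrite kr in hu.
  have [xp|/existsNP[v1 /negP]] := pselect (forall v,
      2 ^+ n <= rnorm v + 2 * 10 ^+ n * rnorm ((x + u) - f v)).
    exists (x + u) => fx; rewrite [x + u - x]addrC addKr ur; split=> //.
    by case: fx fu => [a _ <-] [b _ <-]; exists (a + b); rewrite ?(linD lf).
  have [xm|/existsNP[v2 /negP]] := pselect (forall v,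
      2 ^+ n <= rnorm v + 2 * 10 ^+ n * rnorm ((x - u) - f v)).
    exists (x - u) => fx; rewrite [x - u - x]addrAC subrr add0r rnormN ur; split=> //.
    by case: fx fu => [a _ <-] [b _ <-]; exists (a - b); rewrite ?(linB lf).
  rewrite -!ltNge => h2 h1; exfalso.
  have := hu ((2^-1)%:C *: (v1 - v2)).
  have -> : u - f ((2^-1)%:C *: (v1 - v2)) =
      (2^-1)%:C *: ((x + u - f v1) - (x - u - f v2)).
    rewrite (linZ lf) (linB lf).
    have {1}-> : u = (2^-1)%:C *: (u + u).
      rewrite scalerDr -scalerDl -rmorphD/= -[u in LHS]scale1r.
      by congr (_ *: _); rewrite -(rmorph1 (real_complex R)); congr (_%:C); lra.
    rewrite -scalerBr; congr (_ *: _).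
    by rewrite !opprD !opprK [RHS]addrACA [x + u + _]addrACA subrr add0r.
  rewrite !rnormZr ger0_norm//.
  have := rnormB v1 v2; have := rnormB (x + u - f v1) (x - u - f v2).
  move=> h3 h4; have : 10 ^+ n * rnorm (x + u - f v1 - (x - u - f v2)) <=
     10 ^+ n * (rnorm (x + u - f v1) + rnorm (x - u - f v2)).
    by rewrite ler_wpM2l// ltW.
  lra.
pose u := fix u n := if n is n.+1 then sval (cid (step n (u n))) else 0.
have uf n : range f (u n).
  elim: n => [|n ih]; first by exists 0 => //; rewrite (lin0 lf).
  by rewrite /=; case: cid => y /= /(_ ih)[].
have u1 n : rnorm (u n.+1 - u n) <= 1 * 5^-1 ^+ n.
  by rewrite mul1r /=; case: cid => y /= /(_ (uf n))[].
have u2 n v : 2 ^+ n <= rnorm v + 2 * 10 ^+ n * rnorm (u n.+1 - f v).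
  by rewrite /=; case: cid => y /= /(_ (uf n))[].
have [||x hx] := geometric_cvg _ _ u1; [lra|lra|].
have e5 : 1 / (1 - 5^-1) = 5 / 4 :> R by field.
rewrite e5 in hx.
have [v _ vx] : range f x.
  apply: cf => e e0.
  have [||n hn] := @exprn_small R 5^-1 (5 / 4) e _ _ e0; [lra|lra|].
  by exists (u n) => //; rewrite rnorm_distC (le_lt_trans (hx n)).
(* The limit is within [4^-1 * 5^-1 ^+ n] of [u n.+1], which costs half of [2 ^+ n] in [u2]; a
   preimage [v] of the limit would then be arbitrarily large. *)
have v2 n : 2 ^+ n <= 2 * rnorm v.
  have := u2 n v; rewrite vx rnorm_distC => h.
  have : 10 ^+ n * rnorm (x - u n.+1) <= 10 ^+ n * (4^-1 * 5^-1 ^+ n).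
    rewrite ler_wpM2l ?exprn_ge0//; have := hx n.+1; rewrite exprS; lra.
  rewrite mulrCA -exprMn (_ : 10 * 5^-1 = 2 :> R); last lra.
  lra.
have [||n] := @exprn_small R 2^-1 (2 * rnorm v) 1 _ _ ltr01; [lra|lra|].
by rewrite exprVn ltr_pdivrMr ?exprn_gt0// mul1r ltNge v2.
Qed.

(** Each approximate lift halves the residual and keeps it in the range of [f], so the corrections
    form a geometric series of ratio 1/2; its sum gives the factor 2 in [2 * c]. *)
Lemma open_mapping (M : R) : bounded_by f M -> closed (range f) ->
  exists2 c : R, 0 < c & forall w, range f w ->
    exists2 v, f v = w & rnorm v <= c * rnorm w.
Proof.
move=> fM /approximate_lift[c c0 hc]; exists (2 * c); first lra.
have {}hc w : exists v, range f w ->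
    rnorm v <= c * rnorm w /\ rnorm (w - f v) <= 2^-1 * rnorm w.
  have [/hc[v h1 h2]|nw] := pselect (range f w); first by exists v.
  by exists 0.
have [phi hphi] := choice hc.
move=> w fw.
pose r := fix r n := if n is n.+1 then r n - f (phi (r n)) else w.
pose s := fix s n := if n is n.+1 then s n + phi (r n) else 0.
have rf n : range f (r n).
  elim: n => [//|n [a _ ra]] /=.
  by exists (a - phi (r n)) => //; rewrite (linB lf) ra.
have rn n : rnorm (r n) <= rnorm w * 2^-1 ^+ n.
  elim: n => [|n ih]; first by rewrite expr0 mulr1.
  rewrite /= (le_trans (hphi _ (rf n)).2)// exprS mulrCA ler_wpM2l//.
have rs n : r n = w - f (s n).
  elim: n => [|n ih] /=; first by rewrite (lin0 lf) subr0.
  by rewrite (linD lf) opprD addrA -ih.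
have s1 n : rnorm (s n.+1 - s n) <= c * rnorm w * 2^-1 ^+ n.
  rewrite /= addrC addKr (le_trans (hphi _ (rf n)).1)// -mulrA.
  by rewrite ler_wpM2l// ltW.
have [||v hv] := geometric_cvg _ _ s1; [lra|lra|].
have e2 : c * rnorm w / (1 - 2^-1) = 2 * c * rnorm w by field.
rewrite e2 in hv.
exists v; last by have := hv 0%N; rewrite /= subr0 expr0; lra.
apply/eqP; rewrite -subr_eq0; apply/eqP/rnorm_le_eps0 => e e0.
pose K := `|M| * (2 * c * rnorm w) + rnorm w.
have [||n hn] := @exprn_small R 2^-1 K e _ _ e0; [lra|lra|].
have -> : f v - w = f (v - s n) - r n.
  by rewrite rs (linB lf) opprB addrA subrK.
apply: le_trans (ltW hn); rewrite (le_trans (rnormB _ _))//.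
rewrite /K mulrDl lerD// (le_trans (fM _))//.
rewrite (le_trans (ler_wpM2r (rnorm_ge0 _) (ler_norm M)))// -[leRHS]mulrA.
by rewrite ler_wpM2l.
Qed.

End OpenMapping.

(** * Hermitian forms *)

Section Forms.
Context {R : realType}.
Local Notation C := R[i].

Definition hermitian_form (X : lmodType C) (b : X -> X -> C) : Prop :=
  (forall y, linear (fun x => b x y : C^o)) /\ forall x y, b y x = (b x y)^*.

Section Hermitian.
Variables (X : lmodType C) (b : X -> X -> C).
Hypothesis hb : hermitian_form b.
Let re x y := complex.Re (b x y).

Lemma hformDl x x' y : b (x + x') y = b x y + b x' y.
Proof. exact: (linD (hb.1 y)). Qed.

Lemma hformBl x x' y : b (x - x') y = b x y - b x' y.
Proof. exact: (linB (hb.1 y)). Qed.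

Lemma hformZl a x y : b (a *: x) y = a * b x y.
Proof. exact: (linZ (hb.1 y)). Qed.

Lemma hformDr x y y' : b x (y + y') = b x y + b x y'.
Proof. by rewrite hb.2 hformDl rmorphD/= -!hb.2. Qed.

Lemma hformBr x y y' : b x (y - y') = b x y - b x y'.
Proof. by rewrite hb.2 hformBl rmorphB/= -!hb.2. Qed.

Lemma hformZr a x y : b x (a *: y) = a^* * b x y.
Proof. by rewrite hb.2 hformZl rmorphM/= -hb.2. Qed.

Lemma re_hformC x y : re x y = re y x.
Proof. by rewrite /re (hb.2 y x); case: (b y x). Qed.

Lemma re_hformZ (t : R) x y : re (t%:C *: x) y = t * re x y.
Proof. by rewrite /re hformZl; case: (b x y) => u v /=; ring. Qed.

Lemma re_hformD x x' y : re (x + x') y = re x y + re x' y.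
Proof. by rewrite /re hformDl raddfD. Qed.

Lemma re_hform_sqr (t : R) x y :
  re (x + t%:C *: y) (x + t%:C *: y) = re x x + 2 * t * re x y + t ^+ 2 * re y y.
Proof.
rewrite re_hformD re_hformZ !(re_hformC _ (x + _)) !re_hformD !re_hformZ.
rewrite (re_hformC y x); ring.
Qed.

End Hermitian.

Section Hilbert.
Variable H : hilbertType R.
Implicit Types x y : H.

Lemma inner_hermitian : hermitian_form (fun x y : H => <<| x, y |>>).
Proof.
split=> [y a x x'|x y]; first exact: linearPl.
by rewrite hermC expr0 mul1r.
Qed.

Lemma re_inner x : complex.Re <<| x, x |>> = rnorm x ^+ 2.
Proof. by rewrite -sqr_norm_inner normE -rmorphXn. Qed.

Lemma re_inner_le x y : complex.Re <<| x, y |>> <= rnorm x * rnorm y.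
Proof.
have [|] := leP (rnorm x * rnorm y) 0.
  rewrite le_eqVlt ltNge mulr_ge0 ?rnorm_ge0// orbF mulf_eq0.
  move=> /orP[] /eqP /rnorm_eq0 ->; rewrite ?linear0l ?linear0r rnorm0 ?mul0r ?mulr0//.
move=> xy0.
(* Expanding this square leaves [rnorm x * rnorm y] as a common factor, which is positive here. *)
have := sqr_ge0 (rnorm ((rnorm y)%:C *: x + (- rnorm x)%:C *: y)).
rewrite -re_inner (re_hform_sqr inner_hermitian) !(re_hformZ inner_hermitian).
rewrite (re_hformC inner_hermitian x) (re_hformZ inner_hermitian) !re_inner.
move=> h; have {}h : 0 <= (rnorm x * rnorm y) * (rnorm x * rnorm y - complex.Re <<|x, y|>>).
  lra.
by rewrite -subr_ge0 -(pmulr_rge0 _ xy0).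
Qed.

Lemma rnorm_inner x y : rnorm <<| x, y |>> <= rnorm x * rnorm y.
Proof.
have [|c0] := leP (rnorm <<| x, y |>>) 0.
  by move=> /le_trans; apply; rewrite mulr_ge0 ?rnorm_ge0.
(* Multiplying [x] by the conjugate of the inner product makes the new inner product real and
   nonnegative. *)
have := re_inner_le ((<<| x, y |>>)^* *: x) y.
rewrite rnormZ (hformZl inner_hermitian) mulrC -sqr_normc normE -rmorphXn/=.
by rewrite {2}/rnorm normcJ expr2 -mulrA ler_pM2l.
Qed.

Lemma inner_inj x y : (forall u, <<| u, x |>> = <<| u, y |>>) -> x = y.
Proof.
move=> h; apply/eqP; rewrite -subr_eq0; apply/eqP/rnorm_eq0/eqP.
by rewrite -sqrf_eq0 -re_inner (hformBr inner_hermitian) h subrr.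
Qed.

End Hilbert.

(** * Riesz representation for coercive forms *)

Section Coercive.
Variables (X : completeNormedModType C) (b : X -> X -> C) (c M : R).
Hypothesis hb : hermitian_form b.
Hypothesis c0 : 0 < c.
Hypothesis bM : forall x y, rnorm (b x y) <= M * rnorm x * rnorm y.
Hypothesis bc : forall x, c * rnorm x ^+ 2 <= complex.Re (b x x).

(* The representing vector minimises [b x x - 2 Re (l x)]; a minimising
   sequence is Cauchy by the parallelogram identity. *)
Lemma riesz (l : X -> C^o) (L : R) : linear l -> bounded_by l L ->
  exists k, forall x, l x = b x k.
Proof.
move=> ll lL.
pose re x y := complex.Re (b x y).
pose lam x := complex.Re (l x).
pose F x := re x x - 2 * lam x.
have F_lb x : - (L ^+ 2 / c) <= F x.
  have := bc x; have := le_trans (Re_le_rnorm (l x)) (lL x).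
  rewrite -/(lam x) -/(re x x) /F => h1 h2.
  have : 0 <= c^-1 * (c * rnorm x - L) ^+ 2 by rewrite mulr_ge0 ?invr_ge0 ?sqr_ge0 ?ltW.
  have -> : c^-1 * (c * rnorm x - L) ^+ 2 =
      c * rnorm x ^+ 2 - 2 * (L * rnorm x) + L ^+ 2 / c by field; rewrite gt_eqF.
  lra.
pose m := inf (range F).
have F_hlb : has_lbound (range F) by exists (- (L ^+ 2 / c)) => _ [x _ <-].
have Fm x : m <= F x by apply: ge_inf => //; exists x.
(* The accuracy [4^-1 ^+ n] is the square of the rate [2^-1 ^+ n] wanted for the increments. *)
have [u hu] : {u : nat -> X & forall n, F (u n) < m + 4^-1 ^+ n}.
  apply: (@choice _ _ (fun n x => F x < m + 4^-1 ^+ n)) => n.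
  have e0 : (0 : R) < 4^-1 ^+ n by rewrite exprn_gt0.
  have [|_ [x _ <-] hx] := @inf_adherent R (range F) _ e0; last by exists x.
  by split=> //; exists (F 0), 0.
have lamD (t : R) x y : lam (x + t%:C *: y) = lam x + t * lam y.
  by rewrite /lam (linD ll) (linZ ll) raddfD/=; case: (l y) => p q /=; rewrite mul0r subr0.
(* Comparison with the midpoint bounds the squared increment by [4 / c * 4^-1 ^+ n]; [4 / c + 1]
   dominates the square root of [4 / c]. *)
pose K := 4 / c + 1.
have u1 n : rnorm (u n.+1 - u n) <= K * 2^-1 ^+ n.
  have K0 : 0 <= K by rewrite /K addr_ge0 ?divr_ge0 ?ltW.
  rewrite -ler_sqr ?nnegrE ?rnorm_ge0 ?mulr_ge0 ?exprn_ge0//.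
  rewrite exprMn -exprM mulnC exprM (_ : 2^-1 ^+ 2 = 4^-1 :> R); last by field.
  set d := u n.+1 - u n.
  have := Fm (u n + (2^-1)%:C *: d); have := hu n; have := hu n.+1.
  have -> : u n.+1 = u n + 1%:C *: d by rewrite scale1r /d addrC subrK.
  rewrite /F !lamD /re !(re_hform_sqr hb) -!/(re _ _) expr1n [_ ^+ n.+1]exprS => h1 h2 h3.
  have e0 : (0 : R) < 4^-1 ^+ n by rewrite exprn_gt0.
  have h4 : c * rnorm d ^+ 2 <= 4 * 4^-1 ^+ n.
    have := bc d; rewrite -/(re d d); lra.
  rewrite -(ler_pM2l c0) (le_trans h4)// mulrA ler_pM2r//.
  have -> : c * K ^+ 2 = 16 / c + 8 + c by rewrite /K; field; rewrite gt_eqF.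
  have : 0 < 16 / c by rewrite divr_gt0.
  by move: (16 / c) c0 => s; lra.
have [||k hk] := geometric_cvg _ _ u1; [lra|lra|].
have rk y : lam y = re k y.
  pose B := (re y y + 1) / 2.
  (* For [t = 2^-1 ^+ n], moving from [u n] by [t] or [- t] times [y] cannot lower [F] by more than
     [t ^+ 2]; expanding and dividing by [2 * t] gives [B]. *)
  have un n : `|re (u n) y - lam y| <= B * 2^-1 ^+ n.
    pose t : R := 2^-1 ^+ n.
    have t2 : 4^-1 ^+ n = t * t by rewrite /t -exprMn; congr (_ ^+ _); lra.
    have t0 : 0 < t by rewrite /t exprn_gt0.
    have := Fm (u n + t%:C *: y); have := Fm (u n + (- t)%:C *: y); have := hu n.
    rewrite /F !lamD /re !(re_hform_sqr hb) -!/(re _ _) t2 -/t => h1 h2 h3.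
    rewrite ler_norml; apply/andP; split; rewrite -(ler_pM2l t0) /B; lra.
  apply/eqP; rewrite -subr_eq0; apply/eqP.
  suff : rnorm ((lam y - re k y)%:C : C) = 0.
    by rewrite rnorm_real => /normr0P/eqP.
  suff -> : (lam y - re k y)%:C = 0 :> C by rewrite rnorm0.
  apply: rnorm_le_eps0 => e e0; rewrite rnorm_real.
  pose D := B + `|M| * (K / (1 - 2^-1)) * rnorm y.
  have [||n hn] := @exprn_small R 2^-1 D e _ _ e0; [lra|lra|].
  apply: le_trans (ltW hn).
  have -> : lam y - re k y = - (re (u n) y - lam y) - re (k - u n) y.
    by rewrite /re (hformBl hb) raddfB/=; ring.
  rewrite (le_trans (ler_normB _ _))// normrN /D mulrDl lerD//.
  have : `|re (k - u n) y| <= rnorm (b (k - u n) y).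
    by rewrite -lecR -normE; exact: normc_ge_Re.
  move=> /le_trans; apply; rewrite (le_trans (bM _ _))//.
  rewrite [leRHS]mulrAC ler_wpM2r ?rnorm_ge0//.
  rewrite (le_trans (ler_wpM2r (rnorm_ge0 _) (ler_norm M)))// -[leRHS]mulrA.
  by rewrite ler_wpM2l.
(* So far only real parts agree; evaluation at ['i%C *: x] yields the imaginary parts. *)
exists k => x; have h1 := rk x; have := rk ('i%C *: x).
rewrite /re !(re_hformC hb k) in h1 *.
rewrite /lam (linZ ll) (hformZl hb); move: h1; rewrite /lam.
case: (l x) => p q; case: (b x k) => p' q' /= -> h.
by congr Complex; move: h; lra.
Qed.

End Coercive.
End Forms.

(** * Bounded right inverses from a lower bound on the adjoint *)

Section RightInverse.
Context {R : realType}.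
Local Notation C := R[i].

(** [T x = 0] forces [rnorm x <= q * rnorm x], so solutions are unique, and uniqueness makes the
    chosen solution linear. *)
Lemma neumann_inverse (V : completeNormedModType C) (T : V -> V) (q : R) :
  linear T -> 0 <= q -> q < 1 -> bounded_by (fun x => T x - x) q ->
  exists S : V -> V,
    [/\ linear S, bounded_by S (1 - q)^-1 & forall g, T (S g) = g].
Proof.
move=> lT q0 q1 hT.
have /choice[S hS] g : exists h, T h = g /\ (1 - q) * rnorm h <= rnorm g.
  by have [h] := neumann lT q0 q1 hT g; exists h.
have T0 x : T x = 0 -> x = 0.
  move=> Tx; apply: rnorm_eq0; have := hT x; rewrite Tx sub0r rnormN.
  by have := rnorm_ge0 x; nra.
exists S; split=> [a x y|x|g]; last exact: (hS g).1.
- apply/eqP; rewrite -subr_eq0; apply/eqP/T0.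
  by rewrite (linB lT) lT !(hS _).1 subrr.
- by rewrite -ler_pdivrMl ?invr_gt0 ?invrK ?(hS x).2//; lra.
Qed.

Variables (X : completeNormedModType C) (b : X -> X -> C) (H : hilbertType R).
Variables (E : X -> H).

(** Coercivity makes representing vectors unique, hence [Es] linear. Applied to [Es h], where
    [b (Es h) (Es h)] is the inner product of [E (Es h)] and [h], it also gives the bound
    [N / c]. *)
Lemma adjoint_exists (c M N : R) : hermitian_form b -> 0 < c ->
  (forall x y, rnorm (b x y) <= M * rnorm x * rnorm y) ->
  (forall x, c * rnorm x ^+ 2 <= complex.Re (b x x)) ->
  linear E -> 0 < N -> bounded_by E N ->
  exists Es : H -> X, [/\ linear Es, bounded_by Es (N / c) &
    forall x h, <<| E x, h |>> = b x (Es h)].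
Proof.
move=> hb c0 bM bc lE N0 hE.
have /choice[Es hEs] h : exists k, forall x, <<| E x, h |>> = b x k.
  apply: (riesz hb c0 bM bc (L := N * rnorm h)) => [a x y|x].
    by rewrite lE linearPl.
  rewrite (le_trans (rnorm_inner _ _))// mulrAC ler_wpM2r ?rnorm_ge0//.
have sep k k' : (forall x, b x k = b x k') -> k = k'.
  move=> h; apply/eqP; rewrite -subr_eq0; apply/eqP/rnorm_eq0/eqP.
  rewrite -sqrf_eq0 eq_le sqr_ge0 andbT -(pmulr_rle0 _ c0) (le_trans (bc _))//.
  by rewrite (hformBr hb) h subrr.
exists Es; split=> [a x y|h|x h]; last exact: hEs.
  apply: sep => u; rewrite -hEs (hformDr hb) (hformZr hb) -!hEs.
  by rewrite (hformDr (inner_hermitian H)) (hformZr (inner_hermitian H)).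
have [|p] := leP (rnorm (Es h)) 0.
  by move=> /le_trans; apply; rewrite !mulr_ge0 ?rnorm_ge0 ?invr_ge0 ?ltW.
rewrite mulrAC ler_pdivlMr// -(ler_pM2l p).
have h1 := bc (Es h).
have := re_inner_le (E (Es h)) h; rewrite hEs => h2.
have h3 := ler_wpM2r (rnorm_ge0 h) (hE (Es h)).
lra.
Qed.

(** The right inverse is [Es] after the inverse of [E \o Es]. The real part of the latter is at
    least [c / K ^+ 2], so a suitable positive multiple of it differs from the identity by a
    contraction. *)
Lemma bounded_right_inverse (Es : H -> X) (c K N N' : R) : 0 < c -> 0 < K ->
  linear E -> bounded_by E N -> linear Es -> bounded_by Es N' ->
  (forall x h, <<| E x, h |>> = b x (Es h)) ->
  (forall x, c * rnorm x ^+ 2 <= complex.Re (b x x)) ->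
  (forall h, rnorm h <= K * rnorm (Es h)) ->
  exists2 J : H -> X, bounded_operator J & forall h, E (J h) = h.
Proof.
move=> c0 K0 lE hE lEs hEs hadj bc hK.
pose a := c / K ^+ 2.
have a0 : 0 < a by rewrite divr_gt0// exprn_gt0.
have M_lb h : a * rnorm h ^+ 2 <= complex.Re <<| E (Es h), h |>>.
  rewrite hadj (le_trans _ (bc _))// /a -mulrA ler_pM2l// ler_pdivrMl ?exprn_gt0//.
  by rewrite -exprMn ler_sqr ?nnegrE ?mulr_ge0 ?rnorm_ge0 ?(ltW K0).
(* The summand [a] makes [m] positive and keeps [s] at most 1. *)
pose m := `|N| * `|N'| + a.
have m0 : 0 < m by rewrite ltr_wpDl ?mulr_ge0.
have M_ub h : rnorm (E (Es h)) <= m * rnorm h.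
  rewrite (le_trans (hE _))// (le_trans (ler_wpM2r (rnorm_ge0 _) (ler_norm N)))//.
  rewrite mulrDl -mulrA -[leLHS]addr0 lerD ?(mulr_ge0 (ltW a0) (rnorm_ge0 _))// ler_wpM2l//.
  rewrite (le_trans (hEs _))// ler_wpM2r ?rnorm_ge0 ?ler_norm//.
(* The squared norm of [h - t E Es h] is at most [1 - 2 a t + m^2 t^2] times that of [h]. This
   factor is least at [t = a / m ^+ 2], with value [1 - s], and [q = 1 - s / 2] has square at least
   [1 - s]. *)
pose t := a / m ^+ 2.
pose s := (a / m) ^+ 2.
have s0 : 0 < s by rewrite exprn_gt0// divr_gt0.
have s1 : s <= 1.
  rewrite expr_le1 ?(divr_ge0 (ltW a0) (ltW m0))// ler_pdivrMr// mul1r.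
  by rewrite /m lerDr mulr_ge0.
pose q := 1 - s / 2.
pose T h := t%:C *: E (Es h).
have lT : linear T.
  by move=> k x y; rewrite /T lEs lE scalerDr !scalerA mulrC.
have hT : bounded_by (fun x => T x - x) q.
  move=> h; rewrite rnorm_distC -ler_sqr ?nnegrE ?mulr_ge0 ?rnorm_ge0//; last by rewrite /q; lra.
  have -> : h - T h = h + (- t)%:C *: E (Es h).
    by rewrite /T rmorphN scaleNr.
  rewrite -re_inner (re_hform_sqr (inner_hermitian H)) !re_inner.
  rewrite (re_hformC (inner_hermitian H)) sqrrN.
  have t0 : 0 <= t by rewrite divr_ge0 ?exprn_ge0 ?ltW.
  have h1 := ler_wpM2l t0 (M_lb h).
  have h2 : t ^+ 2 * rnorm (E (Es h)) ^+ 2 <= t ^+ 2 * (m * rnorm h) ^+ 2.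
    rewrite ler_wpM2l ?sqr_ge0// ler_sqr ?nnegrE ?mulr_ge0 ?rnorm_ge0 ?M_ub//.
    exact: ltW.
  have e1 : t * (a * rnorm h ^+ 2) = s * rnorm h ^+ 2.
    by rewrite /t /s; field; rewrite gt_eqF.
  have e2 : t ^+ 2 * (m * rnorm h) ^+ 2 = s * rnorm h ^+ 2.
    by rewrite /t /s; field; rewrite gt_eqF.
  have := mulr_ge0 (sqr_ge0 (s / 2)) (sqr_ge0 (rnorm h)).
  rewrite /q; rewrite e1 in h1; rewrite e2 in h2; nra.
have [||S [lS hS TS]] := neumann_inverse lT _ _ hT; [rewrite /q; lra..|].
exists (fun h => t%:C *: Es (S h)); last first.
  by move=> h; rewrite (linZ lE); exact: TS.
apply/bounded_operatorP; split.
  by move=> k x y; rewrite lS lEs scalerDr !scalerA mulrC.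
exists (`|t| * `|N'| * `|(1 - q)^-1| + 1) => [|h].
  by rewrite ltr_wpDl// !mulr_ge0.
rewrite rnormZr mulrDl mul1r -[leLHS]addr0 lerD ?rnorm_ge0//.
rewrite -!mulrA ler_wpM2l// (le_trans (hEs _))//.
rewrite (le_trans (ler_wpM2r (rnorm_ge0 _) (ler_norm N')))// ler_wpM2l//.
by rewrite (le_trans (hS _))// ler_wpM2r ?rnorm_ge0 ?ler_norm.
Qed.

End RightInverse.

(** * Products and closed subspaces *)

HB.saturate prod.

Section ProductComplete.
Context {R : realType}.
Local Notation C := R[i].
Variables (U V : completeNormedModType C).

Lemma prod_complete (F : set_system (U * V)) :
  ProperFilter F -> cauchy F -> cvg F.
Proof.
move=> PF /cauchyP cF.
have c1 : cauchy (fst @ F).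
  apply: cauchy_exP => e e0; have [x hx] := cF e e0; exists x.1.
  suff : F [set p | ball x.1 e p.1] by [].
  apply: filterS hx => p; rewrite -!ball_normE /= => hp; apply: le_lt_trans hp.
  by rewrite !normE lecR; exact: (rnorm_fst (x - p)).
have c2 : cauchy (snd @ F).
  apply: cauchy_exP => e e0; have [x hx] := cF e e0; exists x.2.
  suff : F [set p | ball x.2 e p.2] by [].
  apply: filterS hx => p; rewrite -!ball_normE /= => hp; apply: le_lt_trans hp.
  by rewrite !normE lecR; exact: (rnorm_snd (x - p)).
have h1 : cvg (fst @ F) by exact: cauchy_cvg.
have h2 : cvg (snd @ F) by exact: cauchy_cvg.
apply/cvg_ex; exists (lim (fst @ F), lim (snd @ F)) => /=.
move=> A nA; have : F [set x | A (x.1, x.2)] by exact: (cvg_pair h1 h2 nA).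
by apply: filterS => -[].
Qed.

HB.instance Definition _ := Uniform_isComplete.Build (U * V)%type prod_complete.

End ProductComplete.

Section Subspace.
Context {R : realType}.
Local Notation C := R[i].

(** Two closed subspaces have to be Banach spaces in their own right: the kernel of [E z0], which
    parametrises the product graphs, and the graph of [A^*], to which open mapping is applied. *)
Record closedSubspace (X : completeNormedModType C) := ClosedSubspace {
  subspace_set :> set X ;
  subspace0 : subspace_set 0 ;
  subspaceD : forall (a : C) x y,
    subspace_set x -> subspace_set y -> subspace_set (a *: x + y) ;
  subspace_closed : closed subspace_set }.

Variables (X : completeNormedModType C) (S : closedSubspace X).

Definition subspace_type := {x : X | x \in (S : set X)}.

HB.instance Definition _ := [isSub of subspace_type for @sval _ _].
HB.instance Definition _ := [Choice of subspace_type by <:].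

Lemma subspace_submod_closed : submod_closed [pred x | x \in (S : set X)].
Proof.
split=> [|a x y]; rewrite !inE /= => *; first exact: subspace0.
exact: subspaceD.
Qed.

HB.instance Definition _ :=
  GRing.SubChoice_isSubLmodule.Build _ _ _ subspace_type subspace_submod_closed.

Definition subspace_norm (x : subspace_type) : C := `|val x|.

Lemma subspace_normD x y :
  subspace_norm (x + y) <= subspace_norm x + subspace_norm y.
Proof. exact: ler_normD. Qed.

Lemma subspace_normZ (a : C) x : subspace_norm (a *: x) = `|a| * subspace_norm x.
Proof. exact: normrZ. Qed.

Lemma subspace_norm_eq0 x : subspace_norm x = 0 -> x = 0.
Proof. by move=> /normr0_eq0 x0; apply: val_inj. Qed.

HB.instance Definition _ := Lmodule_isNormed.Build C subspace_type
  subspace_normD subspace_normZ subspace_norm_eq0.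

Lemma rnorm_val (x : subspace_type) : rnorm (val x) = rnorm x.
Proof. by []. Qed.

Lemma subspace_complete (F : set_system subspace_type) :
  ProperFilter F -> cauchy F -> cvg F.
Proof.
move=> PF /cauchyP cF.
have c1 : cauchy (val @ F : set_system X).
  apply: cauchy_exP => e e0; have [x hx] := cF e e0; exists (val x).
  suff : F [set y | ball (val x) e (val y)] by [].
  by apply: filterS hx => y; rewrite -!ball_normE.
have Fl : cvg (val @ F : set_system X) by exact: cauchy_cvg.
set l : X := lim _ in Fl.
have Sl : l \in (S : set X).
  rewrite inE; apply: (closed_cvg _ (@subspace_closed _ S) _ _ Fl).
  by apply: nearW => x; have := valP x; rewrite inE.
apply/cvg_ex; exists (exist _ l Sl : subspace_type) => A /nbhs_rnormP[e e0 hA].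
have nl : nbhs l [set y | rnorm (y - l) < e] by apply/nbhs_rnormP; exists e.
have : F [set x | rnorm (val x - l) < e] by exact: (Fl _ nl).
by apply: filterS => x /= hx; apply: hA.
Qed.

HB.instance Definition _ :=
  Uniform_isComplete.Build subspace_type subspace_complete.

End Subspace.

(** * Norm differentiability *)

Section Differentiability.
Context {R : realType}.
Local Notation C := R[i].

Section OperatorNorm.
Variables V W : normedModType C.

(** [norm_differentiable] with the division cleared, so that the estimate also holds at [z0].
    Boundedness near [z0] is bundled in, which makes the notion stable under composition and
    pairing. *)
Definition has_norm_derivative (F : C -> V -> W) (D : V -> W) (z0 : C) : Prop :=
  [/\ bounded_operator D,
      \forall z \near z0, bounded_operator (F z) &
      forall e : R, 0 < e -> \forall z \near z0, forall x,
        rnorm (F z x - F z0 x - (z - z0) *: D x)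
          <= e * rnorm (z - z0) * rnorm x].

Lemma rnorm_opnorm (f : V -> W) (e : R) : linear f ->
  (opnorm f < e%:E)%E -> bounded_by f e.
Proof.
move=> lf fe x; have [|x0] := leP (rnorm x) 0.
  move=> x0; have -> : x = 0.
    by apply/rnorm_eq0/eqP; rewrite eq_le x0 rnorm_ge0.
  by rewrite (lin0 lf) !rnorm0 mulr0.
have : ((complex.Re `|f ((rnorm x)^-1%:C *: x)|)%:E < e%:E)%E.
  apply: le_lt_trans fe; apply: ereal_sup_ubound; exists ((rnorm x)^-1%:C *: x) => //=.
  rewrite normE rnormZr ger0_norm ?invr_ge0 ?rnorm_ge0//.
  by rewrite mulVf ?gt_eqF.
rewrite lte_fin -/(rnorm _) (linZ lf) rnormZr ger0_norm ?invr_ge0 ?rnorm_ge0//.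
by rewrite mulrC ltr_pdivrMr// => /ltW.
Qed.

Lemma opnorm_le (f : V -> W) (e : R) : bounded_by f e -> 0 <= e ->
  (opnorm f <= e%:E)%E.
Proof.
move=> fe e0; apply: ge_ereal_sup => _ [x /= x1 <-].
rewrite lee_fin -/(rnorm _) (le_trans (fe x))// ler_piMr//.
by move: x1; rewrite normE (lecR (rnorm x) 1).
Qed.

Lemma opnorm_ge0 (f : V -> W) : (0 <= opnorm f)%E.
Proof.
apply: (@le_trans _ _ (complex.Re `|f 0|)%:E).
  by rewrite lee_fin -/(rnorm _) rnorm_ge0.
by apply: ereal_sup_ubound; exists 0 => //=; rewrite normr0.
Qed.

Lemma norm_differentiableP (F : C -> V -> W) (z0 : C) :
  (\forall z \near z0, bounded_operator (F z)) ->
  norm_differentiable F z0 <-> exists D, has_norm_derivative F D z0.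
Proof.
move=> nF; have [lF0 _] := nbhs_singleton nF.
pose Q D z x := (z - z0)^-1 *: (F z x - F z0 x) - D x.
have QE D z x : z != z0 ->
    F z x - F z0 x - (z - z0) *: D x = (z - z0) *: Q D z x.
  move=> zz0; rewrite /Q scalerBr scalerA divff ?scale1r//.
  by rewrite subr_eq0.
split=> [[D bD hD]|[D [bD _ hD]]]; exists D => //; last first.
  move=> A nA; have [e /= e0 hA] : exists2 e : R, 0 < e &
      forall r : R, `|r| < e -> A r%:E.
    move: nA => /nbhs_EFin/nbhs_ballP[e /= e0 hA]; exists e => // r re.
    by apply: hA; rewrite -ball_normE /= sub0r normrN.
  have e2 : 0 < e / 2 by lra.
  have : \forall z \near z0, z != z0 -> A (opnorm (Q D z)).
    apply: filterS (hD _ e2) => z hz zz0.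
    have Qz : bounded_by (Q D z) (e / 2).
      move=> x; have := hz x; rewrite QE// rnormZ [leRHS]mulrAC [leRHS]mulrC.
      by rewrite ler_pM2l// rnorm_gt0 subr_eq0.
    have := opnorm_le Qz (ltW e2); have := opnorm_ge0 (Q D z).
    case: (opnorm _) => [r||]; rewrite ?leye_eq ?leeNy_eq//.
    by rewrite !lee_fin => r0 re; apply: hA; rewrite ger0_norm//; lra.
  exact.
split=> // e e0.
have nh : \forall z \near z0, z != z0 -> (opnorm (Q D z) < e%:E)%E.
  exact: (hD _ (@nbhs_open_ereal_lt R 0 (fun=> e) e0)).
apply: (filterS2 _ _ nh nF) => z hz [lFz _] x.
have [->|zz0] := eqVneq z z0; first by rewrite !subrr scale0r subr0 !rnorm0 mulr0 mul0r.
rewrite QE// rnormZ [leRHS]mulrAC [leRHS]mulrC ler_wpM2l ?rnorm_ge0//.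
apply: rnorm_opnorm; last exact: hz.
exact/linear_sub/bD.1/linear_scale/linear_sub.
Qed.

Lemma near_ball (z0 : C) (d : R) : 0 < d -> \forall z \near z0, rnorm (z - z0) < d.
Proof. by move=> d0; apply/nbhs_rnormP; exists d. Qed.

Lemma derivative_lipschitz (F : C -> V -> W) (D : V -> W) (z0 : C) :
  has_norm_derivative F D z0 -> exists2 L : R, 0 < L &
    \forall z \near z0, forall x,
      rnorm (F z x - F z0 x) <= L * rnorm (z - z0) * rnorm x.
Proof.
move=> [/bounded_operatorP[_ [M M0 DM]] _ hF]; exists (1 + M); first lra.
apply: filterS (hF 1 ltr01) => z hz x.
have := rnormD (F z x - F z0 x - (z - z0) *: D x) ((z - z0) *: D x).
rewrite subrK rnormZ => /le_trans; apply.
rewrite mulrDl mulrDl lerD// [leRHS]mulrAC [leRHS]mulrC.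
by rewrite ler_wpM2l ?rnorm_ge0// DM.
Qed.

Lemma bounded_operator_cst (f : V -> W) (M : R) : 0 <= M ->
  linear f -> bounded_by f M -> bounded_operator f.
Proof.
move=> M0 lf fM; apply/bounded_operatorP; split=> //.
by exists (M + 1); [lra|apply: bounded_byW fM; lra].
Qed.

Lemma has_norm_derivative_cst (T : V -> W) (z0 : C) : bounded_operator T ->
  has_norm_derivative (fun=> T) (fun=> 0) z0.
Proof.
move=> bT; split; [|by near=> z|move=> e e0; near=> z => x].
  apply: (@bounded_operator_cst _ 0) => //.
    by move=> a x y; rewrite scaler0 addr0.
  by move=> x; rewrite rnorm0 mul0r.
by rewrite subrr scaler0 subr0 rnorm0 !mulr_ge0 ?rnorm_ge0 ?ltW.
Unshelve. all: by end_near.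
Qed.

End OperatorNorm.

Lemma bounded_comp (U V W : normedModType C) (f : V -> W) (g : U -> V) :
  bounded_operator f -> bounded_operator g -> bounded_operator (f \o g).
Proof.
move=> /bounded_operatorP[lf [M M0 fM]] /bounded_operatorP[lg [N N0 gN]].
apply/bounded_operatorP; split; first by move=> a x y /=; rewrite lg lf.
exists (M * N) => [|x /=]; first exact: mulr_gt0.
by rewrite (le_trans (fM _))// -mulrA ler_pM2l.
Qed.

Lemma bounded_add (V W : normedModType C) (f g : V -> W) :
  bounded_operator f -> bounded_operator g -> bounded_operator (fun x => f x + g x).
Proof.
move=> /bounded_operatorP[lf [M M0 fM]] /bounded_operatorP[lg [N N0 gN]].
apply/bounded_operatorP; split.
  by move=> a x y /=; rewrite lg lf scalerDr addrACA.
exists (M + N) => [|x /=]; first exact: addr_gt0.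
by rewrite (le_trans (rnormD _ _))// mulrDl lerD.
Qed.

Lemma bounded_pair (V W W' : normedModType C) (f : V -> W) (g : V -> W') :
  bounded_operator f -> bounded_operator g -> bounded_operator (fun x => (f x, g x)).
Proof.
move=> /bounded_operatorP[lf [M M0 fM]] /bounded_operatorP[lg [N N0 gN]].
apply/bounded_operatorP; split; first by move=> a x y /=; rewrite lg lf.
exists (M + N) => [|x /=]; first exact: addr_gt0.
apply: rnorm_pair_le => /=; [rewrite (le_trans (fM x))//|rewrite (le_trans (gN x))//].
  by rewrite ler_wpM2r ?rnorm_ge0//; lra.
by rewrite ler_wpM2r ?rnorm_ge0//; lra.
Qed.

Lemma has_norm_derivative_comp (U V W : normedModType C)
    (F : C -> V -> W) (F' : V -> W) (G : C -> U -> V) (G' : U -> V) (z0 : C) :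
  has_norm_derivative F F' z0 -> has_norm_derivative G G' z0 ->
  has_norm_derivative (fun z => F z \o G z)
    (fun x => F z0 (G' x) + F' (G z0 x)) z0.
Proof.
move=> hF hG; have [bF' nF dF] := hF; have [bG' nG dG] := hG.
have bF := nbhs_singleton nF; have bG := nbhs_singleton nG.
have [LG LG0 hLG] := derivative_lipschitz hG.
split.
- apply: bounded_add; first exact: (bounded_comp bF bG').
  exact: (bounded_comp bF' bG).
- by apply: (filterS2 _ _ nF nG) => z; exact: bounded_comp.
move=> e e0.
have /bounded_operatorP[lF0 [N N0 FN]] := bF.
have /bounded_operatorP[lF' [N' N'0 FN']] := bF'.
have /bounded_operatorP[lG0 [P P0 GP]] := bG.
(* Each constant brings one error term of [telescope3] down to [e / 3]. For [rnorm (z - z0) < 1] the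
   norm of [G z x] is at most [(P + LG) * rnorm x], whence [e1]. *)
pose e1 := e / (3 * (P + LG)).
pose e2 := e / (3 * N).
pose d := e / (3 * (N' * LG)).
have e10 : 0 < e1 by rewrite divr_gt0// mulr_gt0// addr_gt0.
have e20 : 0 < e2 by rewrite divr_gt0// mulr_gt0.
have d0 : 0 < d by rewrite divr_gt0// !mulr_gt0.
have nd : \forall z \near z0, rnorm (z - z0) < Num.min 1 d.
  by apply: near_ball; rewrite lt_min ltr01.
apply: (filterS2 _ _ (filterI (dF _ e10) (dG _ e20)) (filterI hLG nd)).
move=> z [hz1 hz2] [hz3]; rewrite lt_min => /andP[z1 zd] x.
set dz := z - z0 in hz1 hz2 hz3 z1 zd *.
have -> : F z (G z x) - F z0 (G z0 x) - dz *: (F z0 (G' x) + F' (G z0 x)) =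
    (F z (G z x) - F z0 (G z x) - dz *: F' (G z x)) +
    F z0 (G z x - G z0 x - dz *: G' x) + dz *: F' (G z x - G z0 x).
  by rewrite !(linB lF0) (linZ lF0) (linB lF') scalerBr scalerDr -telescope3.
have h1 := hz1 (G z x); have h2 := hz2 x; have h3 := hz3 x.
rewrite (le_trans (rnormD _ _))// (le_trans (lerD (rnormD _ _) (lexx _)))//.
rewrite rnormZ.
have Gz : rnorm (G z x) <= (P + LG) * rnorm x.
  have := rnormD (G z x - G z0 x) (G z0 x); rewrite subrK => /le_trans; apply.
  rewrite mulrDl addrC lerD// (le_trans h3)// ler_wpM2r ?rnorm_ge0//.
  by rewrite ler_piMr ?(ltW LG0)// ltW.
have g1 : e1 * rnorm dz * rnorm (G z x) <= e / 3 * rnorm dz * rnorm x.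
  have -> : e / 3 * rnorm dz * rnorm x = e1 * rnorm dz * ((P + LG) * rnorm x).
    by rewrite /e1; field; rewrite gt_eqF// addr_gt0.
  by rewrite ler_wpM2l ?(mulr_ge0 (ltW e10) (rnorm_ge0 _)).
have g2 : rnorm (F z0 (G z x - G z0 x - dz *: G' x)) <= e / 3 * rnorm dz * rnorm x.
  have -> : e / 3 * rnorm dz * rnorm x = N * (e2 * rnorm dz * rnorm x).
    by rewrite /e2; field; rewrite gt_eqF.
  by rewrite (le_trans (FN _))// ler_pM2l.
have g3 : rnorm dz * rnorm (F' (G z x - G z0 x)) <= e / 3 * rnorm dz * rnorm x.
  have -> : e / 3 * rnorm dz * rnorm x = rnorm dz * (N' * (LG * d * rnorm x)).
    by rewrite /d; field; rewrite !gt_eqF.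
  rewrite ler_wpM2l ?rnorm_ge0// (le_trans (FN' _))// ler_pM2l//.
  by rewrite (le_trans h3)// ler_wpM2r ?rnorm_ge0// ler_pM2l// ltW.
lra.
Qed.

Lemma has_norm_derivative_pair (V W W' : normedModType C)
    (F : C -> V -> W) (F' : V -> W) (G : C -> V -> W') (G' : V -> W') (z0 : C) :
  has_norm_derivative F F' z0 -> has_norm_derivative G G' z0 ->
  has_norm_derivative (fun z x => (F z x, G z x)) (fun x => (F' x, G' x)) z0.
Proof.
move=> [bF' nF dF] [bG' nG dG]; split; first exact: bounded_pair.
  by apply: (filterS2 _ _ nF nG) => z; exact: bounded_pair.
move=> e e0; apply: (filterS2 _ _ (dF _ e0) (dG _ e0)) => z h1 h2 x.
by apply: rnorm_pair_le; [exact: h1|exact: h2].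
Qed.

(** Near [z0] the operator [T z] is within 1/2 of the identity, so its inverse has norm at most 2.
    The case where [T z0] is the identity suffices for [E z \o J]. *)
Lemma has_norm_derivative_inverse (V : completeNormedModType C)
    (T : C -> V -> V) (T' : V -> V) (z0 : C) :
  has_norm_derivative T T' z0 -> (forall x, T z0 x = x) ->
  exists2 S : C -> V -> V, has_norm_derivative S (fun x => - T' x) z0 &
    \forall z \near z0, cancel (T z) (S z) /\ cancel (S z) (T z).
Proof.
move=> hT T0; have [bT' nT dT] := hT.
have [L L0 hL] := derivative_lipschitz hT.
have /bounded_operatorP[lT' [N N0 TN]] := bT'.
have h2 : (0 : R) < 2^-1 by lra.
have small : \forall z \near z0,
    linear (T z) /\ forall x, rnorm (T z x - x) <= 2^-1 * rnorm x.
  have L2 : 0 < (2 * L)^-1 by rewrite invr_gt0 mulr_gt0.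
  apply: (filterS3 _ _ nT hL (near_ball z0 L2)) => z [lTz _] hz zL; split=> // x.
  have := hz x; rewrite T0 => /le_trans; apply; rewrite ler_wpM2r ?rnorm_ge0//.
  by move: zL; rewrite -[_^-1]mul1r ltr_pdivlMr ?mulr_gt0//; lra.
have /choice[S hS] z : exists S : V -> V,
    linear (T z) /\ (forall x, rnorm (T z x - x) <= 2^-1 * rnorm x) ->
    [/\ linear S, bounded_by S 2 & cancel S (T z)].
  have [[lTz hz]|nz] := pselect (linear (T z) /\
    (forall x, rnorm (T z x - x) <= 2^-1 * rnorm x)); last by exists id => /nz.
  have [||S [lS bS TS]] := neumann_inverse lTz _ _ hz; [lra|lra|].
  exists S => _; split=> //; apply: bounded_byW bS.
  by rewrite (_ : 1 - 2^-1 = 2^-1 :> R) ?invrK//; field.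
have inj z : linear (T z) /\ (forall x, rnorm (T z x - x) <= 2^-1 * rnorm x) ->
    injective (T z).
  move=> [lTz hz] x y xy; apply/eqP; rewrite -subr_eq0; apply/eqP/rnorm_eq0.
  have := hz (x - y); rewrite (linB lTz) xy subrr sub0r rnormN.
  have := rnorm_ge0 (x - y); lra.
exists S; last first.
  apply: filterS small => z hz; have [_ _ TS] := hS z hz; split=> // x.
  by apply: (inj z hz); rewrite TS.
have S0 x : S z0 x = x.
  have hz := nbhs_singleton small; have [_ _ TS] := hS _ hz.
  by apply: (inj _ hz); rewrite TS T0.
split.
- apply/bounded_operatorP; split; last by exists N => // x; rewrite rnormN.
  by move=> a x y; rewrite lT' opprD scalerN.
- apply: filterS small => z hz; have [lS bS _] := hS z hz.
  by apply: bounded_operator_cst lS bS; lra.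
move=> e e0; pose e1 := e / 4; pose d := e / (4 * (N * L)).
have e10 : 0 < e1 by rewrite divr_gt0.
have d0 : 0 < d by rewrite divr_gt0// !mulr_gt0.
apply: (filterS3 _ _ (filterI small (dT _ e10)) hL (near_ball z0 d0)).
move=> z [hz dTz] hLz zd g; have [lS bS TS] := hS z hz.
set dz := z - z0 in dTz hLz zd *; set h := S z g.
rewrite S0.
(* Since [g = T z h], the error is the remainder of [T] at [h] plus the effect of putting [h] for
   [g] in [T']; the latter is of second order because [h - g] is of order [dz]. *)
have -> : h - g - dz *: - T' g =
    - (T z h - T z0 h - dz *: T' h) - dz *: T' (h - g).
  rewrite T0 TS (linB lT') scalerN scalerBr !opprB opprK.
  by rewrite [X in _ = X + _]addrC -[RHS]addrA [dz *: T' h + _]addrC subrK.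
rewrite (le_trans (rnormB _ _))// rnormN rnormZ.
have hg : rnorm h <= 2 * rnorm g := bS g.
have g1 : rnorm (T z h - T z0 h - dz *: T' h) <= e / 2 * rnorm dz * rnorm g.
  rewrite (le_trans (dTz _))// (_ : e / 2 * _ * _ = e1 * rnorm dz * (2 * rnorm g)).
    by rewrite ler_wpM2l// mulr_ge0 ?rnorm_ge0// ltW.
  by rewrite /e1; field.
have g2 : rnorm dz * rnorm (T' (h - g)) <= e / 2 * rnorm dz * rnorm g.
  have -> : e / 2 * rnorm dz * rnorm g = rnorm dz * (N * (L * d * (2 * rnorm g))).
    by rewrite /d; field; rewrite !gt_eqF.
  rewrite ler_wpM2l ?rnorm_ge0// (le_trans (TN _))// ler_pM2l//.
  rewrite rnorm_distC -(T0 h) -(TS g) -/h (le_trans (hLz h))//.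
  apply: ler_pM; rewrite ?mulr_ge0 ?rnorm_ge0 ?(ltW L0) ?ler_pM2l//.
  - by rewrite ltW.
  - by rewrite TS.
lra.
Qed.

End Differentiability.

(** * Resolutions of kernels *)

Section Resolution.
Context {R : realType}.
Local Notation C := R[i].

Lemma closed_preimage0 (V W : normedModType C) (f : V -> W) :
  bounded_operator f -> closed [set x | f x = 0].
Proof.
move=> /bounded_operatorP[lf [M M0 fM]]; apply/closed_rnormP => x hx /=.
apply: rnorm_le_eps0 => e e0.
have [y /= fy yx] := hx (e / M) (divr_gt0 e0 M0).
have := fM (y - x); rewrite (linB lf) fy sub0r rnormN => /le_trans; apply.
by move: yx; rewrite ltr_pdivlMr// mulrC => /ltW.
Qed.

(** The inverse of [Q z] is [x |-> x - J (E z0 x)], the projection onto the kernel at [z0] along the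
    range of [J], restricted to the kernel at [z]. For injectivity, a difference [d] of two points
    with equal image satisfies [d = J (S z (E z d))], and applying [E z0] kills the left side. *)
Lemma kernel_resolution (X W : completeNormedModType C)
    (E : C -> X -> W) (E' : X -> W) (J : W -> X) (z0 : C) :
  has_norm_derivative E E' z0 -> bounded_operator J ->
  (forall h, E z0 (J h) = h) ->
  exists (N : completeNormedModType C) (Q : C -> N -> X) (Q' : N -> X),
    has_norm_derivative Q Q' z0 /\
    \forall z \near z0, injective (Q z) /\ range (Q z) = [set x | E z x = 0].
Proof.
move=> hE bJ EJ; have [bE' nE _] := hE; have bE0 := nbhs_singleton nE.
have [lE0 _] := bE0; have [lJ _] := bJ.
(* The summand [E z0 0] is the zero derivative of the constant [J], carried through [E z0]. *)
have hEJ : has_norm_derivative (fun z => E z \o J) (fun x => E z0 0 + E' (J x)) z0.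
  exact: has_norm_derivative_comp hE (has_norm_derivative_cst z0 bJ).
have [S hS TS] := has_norm_derivative_inverse hEJ EJ.
have ker0 : E z0 0 = 0 by exact: lin0.
have kerD a x y : E z0 x = 0 -> E z0 y = 0 -> E z0 (a *: x + y) = 0.
  by move=> hx hy; rewrite lE0 hx hy scaler0 addr0.
pose N := ClosedSubspace ker0 kerD (closed_preimage0 bE0).
have Nker (n : subspace_type N) : E z0 (val n) = 0.
  by have := valP n; rewrite inE.
have bval : bounded_operator (fun n : subspace_type N => val n).
  by apply: (@bounded_operator_cst _ _ _ _ 1) => // n; rewrite mul1r.
have hval := has_norm_derivative_cst z0 bval.
have bsub : bounded_operator (fun p : X * X => p.1 - p.2).
  apply: (@bounded_operator_cst _ _ _ _ 2) => //.
    by move=> a x y /=; rewrite scalerBr opprD addrACA.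
  move=> p; have := rnormB p.1 p.2; have := rnorm_fst p; have := rnorm_snd p; lra.
have hQ := has_norm_derivative_comp (has_norm_derivative_cst z0 bsub)
  (has_norm_derivative_pair hval
    (has_norm_derivative_comp (has_norm_derivative_cst z0 bJ)
      (has_norm_derivative_comp hS (has_norm_derivative_comp hE hval)))).
exists (subspace_type N : completeNormedModType C); eexists; eexists; split; first exact: hQ.
have [_ nS _] := hS.
apply: (filterS3 _ _ nE nS TS) => z [lE _] [lS _] [ST TS'] /=.
split=> [n n'|].
  rewrite /= => e; apply: val_inj.
  pose d : X := val n - val n'.
  have dJ : d = J (S z (E z d)).
    rewrite [in RHS]/d (linB lE) (linB lS) (linB lJ) /d; move: e.
    move: (J _) (J _) => a b e.
    have -> : val n = val n' - a + b by rewrite -e subrK.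
    by rewrite addrAC [val n' - a]addrC addrK addrC.
  have Ed : E z0 d = 0 by rewrite (linB lE0) !Nker subrr.
  have : S z (E z d) = 0 by rewrite -[LHS]EJ -dJ.
  move=> Sd; apply/eqP; rewrite -subr_eq0 -/d; apply/eqP.
  by rewrite dJ Sd (lin0 lJ).
apply/seteqP; split=> [_ [n _ <-]|x /= Ex].
  by rewrite /= (linB lE) [E z (J _)]TS' subrr.
have Nx : x - J (E z0 x) \in (N : set X).
  by rewrite inE /= (linB lE0) EJ subrr.
exists (exist _ (x - J (E z0 x)) Nx : subspace_type N) => //=.
rewrite (linB lE) Ex sub0r (linN lS) [S z _]ST (linN lJ) opprK.
by rewrite subrK.
Qed.

End Resolution.

(** * Adjoints and products of operators *)

Section ClosedProduct.
Context {R : realType}.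
Local Notation C := R[i].

(** The graph of the product is the preimage of the graph of [A] under the continuous map
    [(x, y) |-> (B x, y)]. *)
Lemma closed_op_comp (U V W : normedModType C) (A : operator V W) (B : U -> V) :
  closed_operator A -> bounded_operator B ->
  closed_operator (op_comp A (everywhere B)).
Proof.
move=> [[A0 lA] cA] /bounded_operatorP[lB [M M0 BM]]; split.
  split=> [|a x y [_ Ax] [_ Ay]]; first by split=> //=; rewrite (lin0 lB).
  by split=> /=; [split=> //|]; rewrite lB; have [] := lA a _ _ Ax Ay.
apply/closed_rnormP => -[x y] hxy.
suff : graph A (B x, y) by move=> [Ax yE]; split.
move/closed_rnormP: cA; apply=> e e0.
have M1 : 0 < M + 1 by lra.
have [[x' y'] [/= [_ Ax'] yE] d] := hxy (e / (M + 1)) (divr_gt0 e0 M1).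
exists (B x', y') => //; move: d; rewrite ltr_pdivlMr// => d.
apply: le_lt_trans d; rewrite mulrC.
have d0 := rnorm_ge0 ((x', y') - (x, y)).
have hx : rnorm (x' - x) <= rnorm ((x', y') - (x, y)) .
  exact: (rnorm_fst ((x', y') - (x, y))).
have hy : rnorm (y' - y) <= rnorm ((x', y') - (x, y)) .
  exact: (rnorm_snd ((x', y') - (x, y))).
apply: rnorm_pair_le => /=.
  rewrite -(linB lB) (le_trans (BM _))//.
  by rewrite (le_trans (ler_wpM2l (ltW M0) hx))// ler_wpM2r//; lra.
by rewrite (le_trans hy)// ler_peMl//; lra.
Qed.

Section Adjoint.
Variables H1 H2 : hilbertType R.
Implicit Types T : operator H1 H2.

Lemma adjoint_rel_inj T y w w' : densely_defined T ->
  adjoint_rel T y w -> adjoint_rel T y w' -> w = w'.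
Proof.
move=> dT hw hw'; apply/eqP; rewrite -subr_eq0; apply/eqP.
set d := w - w'; apply: rnorm_le_eps0 => e e0.
have [x Tx xd] := dense_rnormP dT d e0.
have [d0|d0] := leP (rnorm d) 0; first by rewrite (le_trans d0)// ltW.
have xd0 : <<|x, d|>> = 0.
  by rewrite (hformBr (inner_hermitian _)) -hw// -hw'// subrr.
have := re_inner_le (d - x) d.
rewrite (hformBl (inner_hermitian _)) xd0 subr0 re_inner expr2 ler_pM2r//.
by rewrite (rnorm_distC d x) => dx; rewrite (le_trans dx)// ltW.
Qed.

Lemma adjointE T y w : densely_defined T -> adjoint_rel T y w ->
  opfun (adjoint T) y = w.
Proof.
move=> dT hw; apply: (adjoint_rel_inj dT _ hw).
by apply: (@xgetPex _ 0 [set w | adjoint_rel T y w]); exists w.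
Qed.

(** Each [x] in the domain of [T] imposes one equation that is continuous in [(y, w)]. *)
Lemma adjoint_rel_closed T : closed [set p | adjoint_rel T p.1 p.2].
Proof.
apply/closed_rnormP => -[y w] hyw x Tx /=.
apply/eqP; rewrite -subr_eq0; apply/eqP.
apply: (@rnorm_le_eps0 _ C) => e e0.
pose K := rnorm (opfun T x) + rnorm x + 1.
have K0 : 0 < K by have := rnorm_ge0 (opfun T x); have := rnorm_ge0 x; rewrite /K; lra.
have [[y' w'] /= h d] := hyw (e / K) (divr_gt0 e0 K0).
have hy : rnorm (y' - y) <= rnorm ((y', w') - (y, w)) .
  exact: (rnorm_fst ((y', w') - (y, w))).
have hw : rnorm (w' - w) <= rnorm ((y', w') - (y, w)) .
  exact: (rnorm_snd ((y', w') - (y, w))).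
have -> : <<| opfun T x, y |>> - <<| x, w |>> =
    <<| x, w' - w |>> - <<| opfun T x, y' - y |>>.
  rewrite !(hformBr (inner_hermitian _)) (h _ Tx) opprB.
  by rewrite [RHS]addrC addrA subrK.
rewrite (le_trans (rnormB _ _))// (le_trans (lerD (rnorm_inner _ _) (rnorm_inner _ _)))//.
have d0 := rnorm_ge0 ((y', w') - (y, w)).
have h1 := ler_wpM2l (rnorm_ge0 x) hw.
have h2 := ler_wpM2l (rnorm_ge0 (opfun T x)) hy.
move: d; rewrite ltr_pdivlMr// /K => d; lra.
Qed.

End Adjoint.

Section LowerBound.
Variables (H1 H2 H : hilbertType R) (A : operator H H2) (B : H1 -> H) (Bs : H -> H1).
Hypothesis dA : densely_defined A.
Hypothesis bBs : bounded_operator Bs.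
Hypothesis adjB : forall x h, <<| B x, h |>> = <<| x, Bs h |>>.
Hypothesis cBA :
  closed_operator (op_comp (adjoint (everywhere B)) (adjoint A)).

(* Closed graph argument: on the domain of A^*, the graph norm of B^* A^*
   dominates that of A^*. *)
Lemma adjoint_graph_bound : exists2 c : R, 0 < c &
  forall y w, adjoint_rel A y w -> rnorm w <= c * rnorm (y, Bs w).
Proof.
have S0 : adjoint_rel A (0 : H2 * H).1 (0 : H2 * H).2.
  by move=> x _; rewrite /= !linear0r.
have SD a (p q : H2 * H) : adjoint_rel A p.1 p.2 -> adjoint_rel A q.1 q.2 ->
    adjoint_rel A (a *: p + q).1 (a *: p + q).2.
  move=> hp hq x Ax /=; rewrite !(hformDr (inner_hermitian _)).
  by rewrite !(hformZr (inner_hermitian _)) hp// hq.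
pose S := @ClosedSubspace R (H2 * H)%type [set p | adjoint_rel A p.1 p.2] S0 SD (@adjoint_rel_closed H H2 A).
have [lBs [N N0 BN]] := (bounded_operatorP Bs).1 bBs.
(* This map sends [(y, A^* y)] to [(y, B^* A^* y)]; its range is the graph that is closed by
   hypothesis. *)
pose f (p : subspace_type S) : H2 * H1 := ((val p).1, Bs (val p).2).
have lf : linear f by move=> a p q; rewrite /f /= lBs.
have fN : bounded_by f (N + 1).
  move=> p; have p0 := rnorm_ge0 p; apply: rnorm_pair_le => /=.
    by rewrite (le_trans (rnorm_fst (val p)))// rnorm_val ler_peMl//; lra.
  rewrite (le_trans (BN _))// (le_trans (ler_wpM2l (ltW N0) (rnorm_snd (val p))))//.
  by rewrite rnorm_val ler_wpM2r//; lra.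
have relB v : adjoint_rel (everywhere B) v (Bs v) by move=> x _; exact: adjB.
have dB : densely_defined (everywhere B) by move=> O [x Ox] _; exists x.
have fE : range f = graph (op_comp (adjoint (everywhere B)) (adjoint A)).
  apply/seteqP; split=> [_ [p _ <-]|[y v] [[[w yw] _] vE]].
    have Sp : adjoint_rel A (val p).1 (val p).2 by have := valP p; rewrite inE.
    split; first by split; [exists (val p).2|exists (Bs (opfun (adjoint A) (val p).1)); exact: relB].
    transitivity (opfun (adjoint (everywhere B)) (opfun (adjoint A) (val p).1)) => //.
    by rewrite (adjointE dA Sp) (adjointE dB (relB _)).
  have Syw : (y, w) \in (S : set (H2 * H)) by rewrite inE.
  exists (exist _ (y, w) Syw : subspace_type S) => //.
  have -> : v = opfun (adjoint (everywhere B)) (opfun (adjoint A) y) by [].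
  by rewrite (adjointE dA yw) (adjointE dB (relB _)).
have cf : closed (range f) by rewrite fE; exact: cBA.2.
have [c c0 hc] := open_mapping lf fN cf.
exists c => // y w yw.
have Syw : (y, w) \in (S : set (H2 * H)) by rewrite inE.
have [|p] := hc (y, Bs w); first by exists (exist _ (y, w) Syw : subspace_type S).
have Sp : adjoint_rel A (val p).1 (val p).2 by have := valP p; rewrite inE.
(* The lift found by open mapping has first component [y], so its second component must be [w]. *)
move=> [py _]; rewrite py in Sp; rewrite (adjoint_rel_inj dA yw Sp).
by move=> h; rewrite (le_trans (rnorm_snd (val p))).
Qed.

End LowerBound.
End ClosedProduct.

(** * Surjectivity of the graph equation and the theorem *)

Section ProductHolomorphy.
Context {R : realType}.
Local Notation C := R[i].
Variables H1 H2 H : hilbertType R.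

Lemma hilbert_adjoint (B : H1 -> H) : bounded_operator B ->
  exists2 Bs : H -> H1, bounded_operator Bs &
    forall x h, <<| B x, h |>> = <<| x, Bs h |>>.
Proof.
move=> /bounded_operatorP[lB [N N0 BN]].
have [||Bs [lBs bBs adjB]] := @adjoint_exists _ H1 (fun x y => <<|x, y|>>)
    H B 1 1 N (inner_hermitian H1) ltr01 _ _ lB N0 BN.
- by move=> x y; rewrite mul1r rnorm_inner.
- by move=> x; rewrite mul1r re_inner.
exists Bs => //; apply: bounded_operator_cst lBs bBs.
by rewrite divr1 ltW.
Qed.

Variables (K : completeNormedModType C).

Definition graph_equation (B : H1 -> H) (r : K -> H * H2) (p : H1 * K) : H :=
  B p.1 - (r p.2).1.

Lemma graph_equation_right_inverse (A : operator H H2) (B : H1 -> H)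
    (r : K -> H * H2) :
  densely_defined A -> bounded_operator B ->
  closed_operator (op_comp (adjoint (everywhere B)) (adjoint A)) ->
  bounded_operator r -> injective r -> closed (range r) -> range r = graph A ->
  exists2 J : H -> H1 * K, bounded_operator J &
    forall h, graph_equation B r (J h) = h.
Proof.
move=> dA bB cBA br ir cr rA.
have [Bs bBs adjB] := hilbert_adjoint bB.
have [c c0 hc] := adjoint_graph_bound dA bBs adjB cBA.
have /bounded_operatorP[lB [N N0 BN]] := bB.
have /bounded_operatorP[lBs [N' N'0 BsN]] := bBs.
have /bounded_operatorP[lr [M M0 rM]] := br.
have [d d0 hd] := open_mapping lr rM cr.
(* Injectivity identifies the controlled preimage with [k], so [r] is bounded below. *)
have {}hd k : rnorm k <= d * rnorm (r k).
  by have [|k' /ir -> //] := hd (r k); exists k.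
pose b (p q : H1 * K) := <<| p.1, q.1 |>> +
  (<<| (r p.2).1, (r q.2).1 |>> + <<| (r p.2).2, (r q.2).2 |>>).
have hb : hermitian_form b.
  split=> [q a p p'|p q].
    rewrite /b /= lr /= !linearPl.
    rewrite -![_ *: _]/(_ * _) !mulrDr.
    by rewrite [RHS]addrACA; congr (_ + _); rewrite addrACA.
  by rewrite /b !rmorphD/= -!(inner_hermitian _).2.
have bM p q : rnorm (b p q) <= (1 + 2 * M ^+ 2) * rnorm p * rnorm q.
  have rfst u : rnorm (r u).1 <= M * rnorm u := le_trans (rnorm_fst _) (rM u).
  have rsnd u : rnorm (r u).2 <= M * rnorm u := le_trans (rnorm_snd _) (rM u).
  have h1 : rnorm <<| p.1, q.1 |>> <= rnorm p * rnorm q.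
    by rewrite (le_trans (rnorm_inner _ _))// ler_pM ?rnorm_ge0 ?rnorm_fst.
  have Mp (s : H1 * K) : M * rnorm s.2 <= M * rnorm s by rewrite ler_pM2l// rnorm_snd.
  have h2 : rnorm <<| (r p.2).1, (r q.2).1 |>> <= (M * rnorm p) * (M * rnorm q).
    rewrite (le_trans (rnorm_inner _ _))// ler_pM ?rnorm_ge0//.
      exact: le_trans (rfst _) (Mp _).
    exact: le_trans (rfst _) (Mp _).
  have h3 : rnorm <<| (r p.2).2, (r q.2).2 |>> <= (M * rnorm p) * (M * rnorm q).
    rewrite (le_trans (rnorm_inner _ _))// ler_pM ?rnorm_ge0//.
      exact: le_trans (rsnd _) (Mp _).
    exact: le_trans (rsnd _) (Mp _).
  rewrite (le_trans (rnormD _ _))// (le_trans (lerD (lexx _) (rnormD _ _)))//.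
  lra.
(* The squared sup norm is at most the sum of the squares, and [rnorm p.2 ^+ 2] costs a factor
   [d ^+ 2] through the lower bound on [r]. *)
pose m := (1 + d ^+ 2)^-1.
have d1 : 0 < 1 + d ^+ 2 by rewrite ltr_pwDl// sqr_ge0.
have m0 : 0 < m by rewrite invr_gt0.
have bc p : m * rnorm p ^+ 2 <= complex.Re (b p p).
  rewrite /b !raddfD/= !re_inner ler_pdivrMl//.
  have r0 := rnorm_ge0 (r p.2).
  have hr : rnorm (r p.2) ^+ 2 <= rnorm (r p.2).1 ^+ 2 + rnorm (r p.2).2 ^+ 2.
    case: (r p.2) => u v; rewrite rnorm_pair /= /Order.max.
    by case: ifP => _; rewrite ?lerDl ?lerDr sqr_ge0.
  have hk : rnorm p.2 ^+ 2 <= d ^+ 2 * rnorm (r p.2) ^+ 2.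
    by rewrite -exprMn ler_sqr ?nnegrE ?mulr_ge0 ?rnorm_ge0 ?(ltW d0).
  have hp : rnorm p ^+ 2 <= rnorm p.1 ^+ 2 + rnorm p.2 ^+ 2.
    case: (p) => u v; rewrite rnorm_pair /= /Order.max.
    by case: ifP => _; rewrite ?lerDl ?lerDr sqr_ge0.
  have h1 := mulr_ge0 (sqr_ge0 d) (sqr_ge0 (rnorm p.1)).
  have h2 := ler_wpM2l (sqr_ge0 d) hr.
  have h3 := sqr_ge0 (rnorm (r p.2).1).
  have h4 := sqr_ge0 (rnorm (r p.2).2).
  lra.
pose E := graph_equation B r.
have lE : linear E.
  move=> a p q; rewrite /E /graph_equation /= lB lr /=.
  by rewrite opprD scalerBr addrACA.
have EN : bounded_by E (N + M).
  move=> p; rewrite (le_trans (rnormB _ _))// mulrDl lerD//.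
    by rewrite (le_trans (BN _))// ler_pM2l// rnorm_fst.
  rewrite (le_trans (rnorm_fst _))// (le_trans (rM _))//.
  by rewrite ler_pM2l// rnorm_snd.
have NM0 : 0 < N + M by exact: addr_gt0.
have [Es [lEs EsN adjE]] := adjoint_exists hb m0 bM bc lE NM0 EN.
(* Testing the adjoint on [(x, 0)] isolates the first component. *)
have Es1 h : (Es h).1 = Bs h.
  apply: inner_inj => x; rewrite -adjB.
  have := adjE (x, 0) h; rewrite /E /graph_equation /b /= (lin0 lr) /= subr0 => ->.
  by rewrite !linear0l !addr0.
(* Testing on [(0, k)], where [r k] runs through the graph of [A], gives the defining relation of
   [A^*]. *)
have Es2 h : adjoint_rel A (- (r (Es h).2).2) (h + (r (Es h).2).1).
  move=> a Aa; have : graph A (a, opfun A a) by [].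
  rewrite -rA => -[k _ rk].
  have := adjE (0, k) h; rewrite /E /graph_equation /b /= (lin0 lB) linear0l rk /=.
  rewrite sub0r add0r (linN ((inner_hermitian _).1 _)) => e.
  rewrite linearNr (hformDr (inner_hermitian _)).
  move: e; set P := <<| a, h |>>; set Q := <<| a, _ |>>; set X := <<| opfun A a, _ |>>.
  move=> e; rewrite -[LHS]/(- X).
  by rewrite -[X](addrK Q) [X + Q]addrC -e opprB opprK addrC.
(* Write [h] as [(h + u.1) - u.1] and bound [h + u.1] by the closed graph estimate. There
   [Bs (h + u.1)] is [(Es h).1 + Bs u.1], and [M + 1 + N' * M] dominates both components of the
   pair. *)
have key h : rnorm h <= (M + c * (M + 1 + N' * M) ) * rnorm (Es h).
  have e0 := rnorm_ge0 (Es h).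
  have rE : rnorm (r (Es h).2) <= M * rnorm (Es h).
    by rewrite (le_trans (rM _))// ler_pM2l// rnorm_snd.
  have r1 := le_trans (rnorm_fst (r (Es h).2)) rE.
  have r2 := le_trans (rnorm_snd (r (Es h).2)) rE.
  set u := r (Es h).2 in r1 r2 *.
  have hw := hc _ _ (Es2 h).
  have hBs : rnorm (Bs (h + u.1)) <= (1 + N' * M) * rnorm (Es h).
    rewrite (linD lBs) -Es1 (le_trans (rnormD _ _))// mulrDl mul1r.
    rewrite lerD ?rnorm_fst// (le_trans (BsN _))// -mulrA ler_pM2l//.
  have hp : rnorm (- u.2, Bs (h + u.1)) <= (M + 1 + N' * M) * rnorm (Es h).
    have NM : 0 <= N' * M * rnorm (Es h) by rewrite !mulr_ge0// ltW.
    have ME : 0 <= M * rnorm (Es h) by rewrite mulr_ge0// ltW.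
    apply: rnorm_pair_le => /=; rewrite ?rnormN; lra.
  have hh : rnorm h <= rnorm (h + u.1) + rnorm u.1.
    by have := rnormB (h + u.1) u.1; rewrite addrK.
  have cp := ler_wpM2l (ltW c0) hp.
  lra.
have K0 : 0 < M + c * (M + 1 + N' * M) by rewrite !(addr_gt0, mulr_gt0).
exact: (bounded_right_inverse m0 K0 lE EN lEs EsN adjE bc key).
Qed.

End ProductHolomorphy.

Theorem proposition5p9 (R : realType) (H1 H2 H : hilbertType R)
    (Theta : set R[i]) (A : R[i] -> operator H H2) (B : R[i] -> H1 -> H) :
  open Theta ->
  holomorphic Theta A ->
  norm_holomorphic Theta B ->
  (forall z, Theta z -> densely_defined (A z)) ->
  (forall z, Theta z -> densely_defined (op_comp (A z) (everywhere (B z)))) ->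
  (forall z, Theta z ->
    closed_operator
      (op_comp (adjoint (everywhere (B z))) (adjoint (A z)))) ->
  holomorphic Theta (fun z => op_comp (A z) (everywhere (B z))).
Proof.
move=> _ [clA diffA] [bB diffB] dA _ clBA.
have clAB z : Theta z -> closed_operator (op_comp (A z) (everywhere (B z))).
  by move=> Tz; apply: closed_op_comp; [exact: clA|exact: bB].
split=> // z0 Tz0.
have [Th [oTh Thz0 sTh [K [r [hr diffr]]]]] := diffA z0 Tz0.
have nTh : \forall z \near z0, Th z by exact: open_nbhs_nbhs.
have nr : \forall z \near z0, bounded_operator (r z).
  by apply: filterS nTh => z /hr[].
have nB : \forall z \near z0, bounded_operator (B z).
  by apply: filterS nTh => z /sTh /bB.
have rangeA z : Th z -> range (r z) = graph (A z).
  move=> /hr[_ _ _ [fr _ sr]]; apply/seteqP; split=> [_ [k _ <-]|//]; exact: fr.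
have [r' hr'] := (norm_differentiableP nr).1 diffr.
have [B' hB'] := (norm_differentiableP nB).1 (diffB z0 Tz0).
have bfst (V W : normedModType R[i]) : bounded_operator (fst : V * W -> V).
  by apply: (@bounded_operator_cst _ _ _ _ 1) => // p; rewrite mul1r rnorm_fst.
have bsnd (V W : normedModType R[i]) : bounded_operator (snd : V * W -> W).
  by apply: (@bounded_operator_cst _ _ _ _ 1) => // p; rewrite mul1r rnorm_snd.
have [J bJ EJ] : exists2 J : H -> H1 * K, bounded_operator J &
    forall h, graph_equation (B z0) (r z0) (J h) = h.
  have [br ir cr _] := hr _ Thz0.
  exact: (graph_equation_right_inverse (dA _ Tz0) (bB _ Tz0) (clBA _ Tz0) br ir cr
    (rangeA _ Thz0)).
have bminus : bounded_operator (fun q : H * (H * H2) => q.1 - q.2.1).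
  apply: (@bounded_operator_cst _ _ _ _ 2) => //.
    by move=> a p q /=; rewrite scalerBr opprD addrACA.
  move=> q; have := rnormB q.1 q.2.1; have := rnorm_fst q.2.
  have := rnorm_fst q; have := rnorm_snd q; lra.
have hE : exists E', has_norm_derivative
    (fun z => graph_equation (B z) (r z)) E' z0.
  eexists; exact: (has_norm_derivative_comp (has_norm_derivative_cst z0 bminus)
    (has_norm_derivative_pair
      (has_norm_derivative_comp hB' (has_norm_derivative_cst z0 (bfst H1 K)))
      (has_norm_derivative_comp hr' (has_norm_derivative_cst z0 (bsnd H1 K))))).
have [E' {}hE] := hE.
have [N [Q [Q' [hQ kerQ]]]] := kernel_resolution hE bJ EJ.
pose F z n := ((Q z n).1, (r z (Q z n).2).2).
have hF : exists F', has_norm_derivative F F' z0.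
  eexists; exact: (has_norm_derivative_pair
    (has_norm_derivative_comp (has_norm_derivative_cst z0 (bfst H1 K)) hQ)
    (has_norm_derivative_comp (has_norm_derivative_cst z0 (bsnd H H2))
      (has_norm_derivative_comp hr'
        (has_norm_derivative_comp (has_norm_derivative_cst z0 (bsnd H1 K)) hQ)))).
have nF : \forall z \near z0, bounded_operator (F z) by have [F' []] := hF.
(* The properties are known only near [z0], whereas an open set on which all of them hold is
   required; the interior of [good] is one. *)
pose good z := [/\ Th z, bounded_operator (F z), injective (Q z) &
  range (Q z) = [set p | graph_equation (B z) (r z) p = 0]].
have ngood : nbhs z0 good.
  by apply: (filterS3 _ _ nTh nF kerQ) => z ? ? [].
exists good°; split.
- exact: open_interior.
- exact: ngood.
- by move=> z /interior_subset[/sTh].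
exists N, F; split; last exact/norm_differentiableP.
move=> z /interior_subset[Tz bF iQ rQ].
have [br ir _ _] := hr z Tz.
have kerE n : B z (Q z n).1 = (r z (Q z n).2).1.
  have : range (Q z) (Q z n) by exists n.
  by rewrite rQ => /subr0_eq.
(* [F] drops the first component of [r z], but the kernel equation recovers it from [(Q z n).1];
   then [r z] is injective. *)
have iF : injective (F z).
  move=> n n' [e1 e2]; apply: iQ.
  have : r z (Q z n).2 = r z (Q z n').2.
    have : (r z (Q z n).2).1 = (r z (Q z n').2).1 by rewrite -!kerE e1.
    by move: e2; case: (r z (Q z n).2) (r z (Q z n').2) => ? ? [? ?] /= -> ->.
  by move/ir; case: (Q z n) (Q z n') e1 => [? ?] [? ?] /= -> ->.
have funF : set_fun setT (graph (op_comp (A z) (everywhere (B z)))) (F z).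
  move=> n _; have : graph (A z) (r z (Q z n).2).
    by rewrite -rangeA//; exists (Q z n).2.
  by rewrite /graph /F /= kerE => -[? ?]; split.
have surF : set_surj setT (graph (op_comp (A z) (everywhere (B z)))) (F z).
  move=> [x y] [/= [_ Ax] yE].
  have : graph (A z) (B z x, y) by [].
  rewrite -rangeA// => -[k _ rk].
  have : range (Q z) (x, k) by rewrite rQ /= /graph_equation /= rk subrr.
  by move=> [n _ Qn]; exists n => //; rewrite /F Qn /= rk.
split=> //; last by split=> // n n' _ _; exact: iF.
(* Closedness of the range is that of the product graph. *)
rewrite (_ : range (F z) = graph (op_comp (A z) (everywhere (B z)))).
  by case: (clAB z (sTh _ Tz)).
by apply/seteqP; split=> [_ [n _ <-]|//]; exact: funF.
Qed.
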